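(* Let $I$ be an index set. If a $\mathbb{C}$-operator space $X$ almost completely coarsely embeds into $\mathrm{OH}(I)$, then there is an index set $J$ such that $X$ is completely $\mathbb{C}$-isomorphic to $\mathrm{OH}(J)$.
   Context: A $\mathbb{C}$-operator space is a closed $\mathbb{C}$-linear subspace $X$ of $B(H)$ for a complex Hilbert space $H$; $M_n(X)$ carries the norm $\|\cdot\|_n$ inherited from $M_n(B(H))=B(H^n)$ ($H^n$ the $\ell_2$-direct sum of $n$ copies of $H$). For a map $f:X\to Y$ between operator spaces and $[x_{ij}]\in M_n(X)$, $f([x_{ij}])$ denotes $[f(x_{ij})]\in M_n(Y)$ (the $n$-th amplification of $f$). Almost complete coarse embedding: $X$ almost completely coarsely embeds into $Y$ if there are functions $\omega,\rho:[0,\infty)\to[0,\infty)$ with $\lim_{t\to\infty}\rho(t)=\infty$ and a sequence of (not necessarily linear) maps $(f^n:X\to Y)_{n\in\mathbb{N}}$ (here $n$ is an index, not a power) such that $$\rho(\|[x_{ij}]-[y_{ij}]\|_n)\le\|f^n([x_{ij}])-f^n([y_{ij}])\|_n\le\omega(\|[x_{ij}]-[y_{ij}]\|_n)$$ for all $n\in\mathbb{N}$ and all $[x_{ij}],[y_{ij}]\in M_n(X)$. Completely $\mathbb{C}$-isomorphic: there is a $\mathbb{C}$-linear bijection $u:X\to Y$ with $\sup_n\|u_n\|<\infty$ and $\sup_n\|(u^{-1})_n\|<\infty$, where $u_n:M_n(X)\to M_n(Y)$ is the entrywise amplification. $\mathrm{OH}(I)$ is Pisier's operator Hilbert space: the unique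 (up to complete isometry) $\mathbb{C}$-operator space that is isometric to $\ell_2(I,\mathbb{C})$ as a Banach space and for which the canonical identification $\ell_2(I,\mathbb{C})\cong\overline{\ell_2(I,\mathbb{C})^*}$ is a complete isometry $\mathrm{OH}(I)\cong\overline{\mathrm{OH}(I)^*}$ (dual and conjugate taken as operator spaces). Equivalently, if $(T_i)_{i\in I}$ is the orthonormal basis, then for any finitely supported family $(a_i)_{i\in I}$ in $M_n(\mathbb{C})$, $\big\|\sum_i a_i\otimes T_i\big\|_{M_n(\mathrm{OH}(I))}=\big\|\sum_i a_i\otimes\overline{a_i}\big\|^{1/2}_{M_n(\mathbb{C})\otimes_{\min}\overline{M_n(\mathbb{C})}}$. *)

(* Defs.v *)
From HB Require Import structures.
From mathcomp Require Import all_boot all_order all_algebra finmap.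
From mathcomp Require Import sesquilinear.
From mathcomp Require Import complex mxtens.
From mathcomp Require Import boolp classical_sets functions cardinality fsbigop reals
  ereal topology normedtype sequences esum.
From mathcomp Require Import ring.
From mathcomp.analysis.showcase Require Import summability.

Set Implicit Arguments.
Unset Strict Implicit.
Unset Printing Implicit Defensive.

Import Order.TTheory GRing.Theory Num.Theory.
Import numFieldNormedType.Exports.

Local Open Scope classical_set_scope.
Local Open Scope ring_scope.

Section Norms.
Context {R : realType}.

(* The norm of a normed space over R[i] takes its values in R[i]; [rnorm] is
   the same number seen in R. *)
Definition rnorm (V : normedZmodType R[i]) (x : V) : R := complex.Re `|x|.

Lemma rnormE (V : normedZmodType R[i]) (x : V) : `|x| = (rnorm x)%:C%C.
Proof. by rewrite /rnorm complex.RRe_real // normr_real. Qed.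

Lemma rnorm_ge0 (V : normedZmodType R[i]) (x : V) : 0 <= rnorm x.
Proof. by rewrite -complex.lecR -rnormE normr_ge0. Qed.

Lemma rnormD (V : normedZmodType R[i]) (x y : V) :
  rnorm (x + y) <= rnorm x + rnorm y.
Proof. by rewrite -complex.lecR rmorphD /= -!rnormE ler_normD. Qed.

Lemma rnormM (x y : R[i]) : rnorm (x * y) = rnorm x * rnorm y.
Proof. by apply: complex.complexI; rewrite rmorphM /= -!rnormE normrM. Qed.

Definition l2norm (V : normedZmodType R[i]) (n : nat) (x : 'cV[V]_n) : R :=
  Num.sqrt (\sum_i rnorm (x i 0) ^+ 2).

Definition opnorm (V W : Type) (nV : V -> R) (nW : W -> R) (T : V -> W) : R :=
  sup [set nW (T x) | x in [set x | nV x <= 1]].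

(* M_n(C) = B(l_2^n) *)
Definition cmxnorm (n : nat) (A : 'M[R[i]]_n) : R :=
  opnorm (@l2norm R[i] n) (@l2norm R[i] n) (fun v => A *m v).

End Norms.

Record hilbert (R : realType) := Hilbert {
  hilbert_sort :> completeNormedModType R[i];
  hdot : {dot hilbert_sort for (@Num.conj R[i])};
  hdotE : forall x, hdot x x = `|x| ^+ 2 }.

Section Operators.
Context {R : realType} (H : hilbert R).

Definition bounded_operators : set (H -> H) :=
  [set T | linear T /\ exists M : R, forall x, rnorm (T x) <= M * rnorm x].

(* The action of M_n(B(H)) on H^n. *)
Definition mxact (n : nat) (T : 'M[H -> H]_n) (x : 'cV[H]_n) : 'cV[H]_n :=
  \col_i \sum_j T i j (x j 0).

Definition mxopnorm (n : nat) (T : 'M[H -> H]_n) : R :=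
  opnorm (@l2norm R H n) (@l2norm R H n) (mxact T).

End Operators.
Arguments bounded_operators {R} H.

(* The linear and matrix-norm data of an operator space; the embedding and
   isomorphism notions below depend on nothing else, so that an operator space
   given up to complete isometry, like OH(I), is given by these data. *)
Record mxnormed (R : realType) := MxNormed {
  mxn_sort :> lmodType R[i];
  mxnorm : forall n : nat, 'M[mxn_sort]_n -> R }.
Arguments mxnorm {R m n}.

(* [os_closed] is sequential closedness, i.e. closedness in the metric of the
   operator norm. *)
Record opspace (R : realType) := OpSpace {
  os_hilbert : hilbert R;
  os_set : set (os_hilbert -> os_hilbert);
  os_bounded : os_set `<=` bounded_operators os_hilbert;
  os_0 : os_set 0;
  os_linear : forall (a : R[i]) S T, os_set S -> os_set T ->
    os_set (a *: S + T);
  os_closed : forall (u : nat -> os_hilbert -> os_hilbert) T,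
    bounded_operators os_hilbert T ->
    (forall k, os_set (u k)) ->
    opnorm (@rnorm R os_hilbert) (@rnorm R os_hilbert) (u k - T) @[k --> \oo]
      --> (0 : R) ->
    os_set T }.

Section OpspaceLmod.
Context {R : realType} (X : opspace R).

Definition os_pred : {pred os_hilbert X -> os_hilbert X} :=
  fun T => `[< os_set (o:=X) T >].

Record os_elt := OsElt { os_val : os_hilbert X -> os_hilbert X;
                         os_valP : os_val \in os_pred }.

HB.instance Definition _ := [isSub for os_val].
HB.instance Definition _ := [Choice of os_elt by <:].

Fact os_submod : submod_closed os_pred.
Proof.
split; first by apply/asboolP; exact: os_0.
by move=> a S T /asboolP hS /asboolP hT; apply/asboolP; exact: os_linear.
Qed.

HB.instance Definition _ :=
  GRing.isSubmodClosed.Build _ _ os_pred os_submod.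
HB.instance Definition _ := [SubChoice_isSubLmodule of os_elt by <:].

Definition os_mxnormed : mxnormed R :=
  @MxNormed R os_elt (fun n A => mxopnorm (map_mx os_val A)).

End OpspaceLmod.
Coercion os_mxnormed : opspace >-> mxnormed.

Lemma esumZ_lty {R : realType} (I : choiceType) (c : R) (f : I -> R) :
  0 <= c -> (forall i, 0 <= f i) ->
  (\esum_(i in [set: I]) (f i)%:E < +oo)%E ->
  (\esum_(i in [set: I]) (c * f i)%:E < +oo)%E.
Proof.
move=> c0 f0 foo; set e := esum _ _ in foo.
have e0 : (0 <= e)%E by apply: esum_ge0 => i _; rewrite lee_fin.
apply: (@le_lt_trans _ _ (c%:E * e)%E); last first.
  by rewrite -ge0_fin_numE ?mule_ge0 // fin_numM // ge0_fin_numE.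
apply: ge_ereal_sup => _ [F FT <-].
under eq_fsbigr do rewrite EFinM.
rewrite -ge0_mule_fsumr; last by move=> i; rewrite lee_fin.
by apply: lee_wpmul2l; rewrite ?lee_fin //; apply: esum_ge; exists F.
Qed.

Section L2.
Context {R : realType} (I : choiceType).

Definition l2_pred : {pred I -> R[i]} :=
  fun x => `[< (\esum_(i in [set: I]) (rnorm (x i) ^+ 2)%:E < +oo)%E >].

Record l2 := L2 { l2_val : I -> R[i]; l2_valP : l2_val \in l2_pred }.

HB.instance Definition _ := [isSub for l2_val].
HB.instance Definition _ := [Choice of l2 by <:].

Fact l2_submod : submod_closed l2_pred.
Proof.
have sq0 (z : R[i]) : 0 <= rnorm z ^+ 2 by exact: sqr_ge0.
split.
  by apply/asboolP; rewrite esum1 // => i _; rewrite /rnorm normr0 expr0n.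
move=> a x y /asboolP hx /asboolP hy; apply/asboolP.
apply: (@le_lt_trans _ _ (\esum_(i in [set: I])
    ((2 * rnorm a ^+ 2 * rnorm (x i) ^+ 2)%:E
     + (2 * rnorm (y i) ^+ 2)%:E))%E).
  apply: le_esum => i _; rewrite -EFinD lee_fin.
  have -> : (a *: x + y) i = a * x i + y i by [].
  have := rnormD (a * x i) (y i); rewrite rnormM.
  have := rnorm_ge0 (a * x i + y i).
  set p := rnorm (_ + _); set q := rnorm a * _; set r := rnorm (y i) => p0 pqr.
  rewrite -mulrA -exprMn -/q.
  apply: (@le_trans _ _ ((q + r) ^+ 2)); first by rewrite lerXn2r ?nnegrE ?(le_trans p0).
  by rewrite -subr_ge0 (_ : _ - _ = (q - r) ^+ 2) ?sqr_ge0 //; ring.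
rewrite esumD; last 2 first.
- by move=> i _; rewrite lee_fin mulr_ge0 ?sq0 // mulr_ge0 ?sq0.
- by move=> i _; rewrite lee_fin mulr_ge0 ?sq0.
by rewrite lte_add_pinfty ?esumZ_lty // mulr_ge0 ?sq0.
Qed.

HB.instance Definition _ := GRing.isSubmodClosed.Build _ _ l2_pred l2_submod.
HB.instance Definition _ := [SubChoice_isSubLmodule of l2 by <:].

(* The coefficient a_i of [x_kl] = sum_i a_i (x) T_i in M_n(l_2(I)), for the
   orthonormal basis T. *)
Definition l2coef (n : nat) (x : 'M[l2]_n) (i : I) : 'M[R[i]]_n :=
  map_mx (fun v => l2_val v i) x.

(* || sum_(i in F) a_i (x) conj(a_i) ||^(1/2); M_n (x)_min conj(M_n) is
   identified with M_(n * n) through entrywise conjugation and the Kronecker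
   product. *)
Definition oh_partial (n : nat) (x : 'M[l2]_n) (F : {fset I}) : R :=
  Num.sqrt (cmxnorm
    (\sum_(i <- F) tensmx (l2coef x i) (map_mx Num.conj (l2coef x i)))).

(* Pisier's formula gives the norm of finitely supported matrices; the limit
   over the finite subsets of I extends it by continuity to M_n(l_2(I)). *)
Definition oh_norm (n : nat) (x : 'M[l2]_n) : R :=
  lim (oh_partial x @ totally).

Definition OH : mxnormed R := @MxNormed R l2 oh_norm.

Lemma oh_norm_finsupp (n : nat) (x : 'M[l2]_n) (F : {fset I}) :
  (forall i, i \notin F -> l2coef x i = 0) -> oh_norm x = oh_partial x F.
Proof.
move=> xF; rewrite /oh_norm.
have eqF (G : {fset I}) : (F `<=` G)%fset -> oh_partial x G = oh_partial x F.
  move=> FG; rewrite /oh_partial -(big_fset_incl _ FG) // => i _ /xF ->.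
  exact: tens0mx.
apply: (@norm_lim_near_cst R R^o _ _ totally_filter).
by exists F => // G /= /eqF.
Qed.

End L2.
Arguments OH R I : clear implicits.

Section Maps.
Context {R : realType}.

Definition almost_completely_coarsely_embeds (X Y : mxnormed R) : Prop :=
  exists omega rho : R -> R, exists f : nat -> X -> Y,
    [/\ forall t, 0 <= t -> 0 <= omega t,
        forall t, 0 <= t -> 0 <= rho t,
        rho t @[t --> +oo] --> +oo
      & forall (n : nat) (x y : 'M[X]_n), (0 < n)%N ->
          rho (mxnorm (x - y))
            <= mxnorm (map_mx (f n) x - map_mx (f n) y)
            <= omega (mxnorm (x - y))].

Definition amp_norm (X Y : mxnormed R) (u : X -> Y) (n : nat) : \bar R :=
  ereal_sup [set (mxnorm (map_mx u x))%:E | x in [set x : 'M[X]_n | mxnorm x <= 1]].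

Definition cb_norm (X Y : mxnormed R) (u : X -> Y) : \bar R :=
  ereal_sup [set amp_norm u n | n in [set n | (0 < n)%N]].

Definition completely_isomorphic (X Y : mxnormed R) : Prop :=
  exists (u : {linear X -> Y}) (v : {linear Y -> X}),
    [/\ cancel u v, cancel v u, (cb_norm u < +oo)%E & (cb_norm v < +oo)%E].

End Maps.

(* Main.v *)
(** Let g_m be the map f^n with n = N^2 = 4^m, translated so that g_m(0) = 0.
A Sylvester matrix h of size n has entries 1 and -1 while h/N is unitary.  Going
from the constant matrix a to the matrix (a + h_ij b) in N steps of norm |b|
changes f^n by O(N) in M_n(OH(I)); on the other hand, the sum of all entries of
the increment is n^2/2 times the second difference f^n(a+b) + f^n(a-b) - 2f^n(a),
up to O(n), and a matrix of norm c has sum of entries at most nc.  Hence second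
differences are O(1/N), and g_m is asymptotically additive.

Let p_m and q_m be the complex linear and conjugate linear parts of g_m.  Along
an ultrafilter, <p_m a, p_m b> + conj <q_m a, q_m b> converges to an inner
product S on X.  The norm of M_k(OH) depends only on the inner products of the
entries, so the bounds on f^n pass to the limit and show that the matrix norms
of X are equivalent to those which the formula for OH gives for S.  As X is
complete, it has an orthonormal basis J for S, and taking coordinates is a
complete isomorphism from X to OH(J). *)

(* The maps f^n may be neither continuous nor homogeneous, omega and rho need not be monotone, and
   the vectors g_m(a) need not converge in l_2(I); this is why the limit is taken of bounded numbers
   only. Once the limit form is sesquilinear, omega and rho enter the final constants through very
   little: the value omega(1), and a threshold beyond which rho stays above a fixed number.

   Additivity rests on a mismatch of scales. A step by (1/N) h_ij b has only the norm of b although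
   it displaces all n^2 entries, so N such steps displace every entry by b or -b; on the other side,
   the bound nc for the sum of entries improves the triangle inequality by a factor n. The first
   difference f^n(a+b) - f^n(a-b) does not spoil this, because the entries of h sum up to n and not
   to n^2.

   Asymptotic additivity yields real linearity only, and the conjugate linear part cannot be
   discarded, since the lower bound for f^n may rest on it. It can be kept because OH is completely
   isometric to its conjugate. *)
From HB Require Import structures.
From mathcomp Require Import all_boot all_order all_algebra finmap.
From mathcomp Require Import spectral.
From mathcomp Require Import complex mxtens.
From mathcomp Require Import boolp classical_sets cardinality fsbigop reals
  ereal topology normedtype esum realfun.
From mathcomp Require Import ring lra.
From mathcomp.analysis.showcase Require Import summability.
Require Import Defs.

Set Implicit Arguments.
Unset Strict Implicit.
Unset Printing Implicit Defensive.

Import Order.TTheory GRing.Theory Num.Theory.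
Import numFieldNormedType.Exports.

Local Open Scope classical_set_scope.
Local Open Scope ring_scope.

(** * Complex numbers and limits along filters *)

Section ComplexModulus.
Context {R : realType}.
Local Notation C := R[i].
Local Notation toC := (real_complex R).

Lemma rnorm0 (V : normedZmodType C) : rnorm (0 : V) = 0.
Proof. by rewrite /rnorm normr0. Qed.

Lemma rnormN (V : normedZmodType C) (x : V) : rnorm (- x) = rnorm x.
Proof. by rewrite /rnorm normrN. Qed.

Lemma rnorm_eq0 (V : normedZmodType C) (x : V) : (rnorm x == 0) = (x == 0).
Proof. by rewrite -[RHS]normr_eq0 rnormE (_ : (0 : C) = toC 0) ?(inj_eq (@complexI R)). Qed.

Lemma rnormB (V : normedZmodType C) (x y : V) : rnorm (x - y) = rnorm (y - x).
Proof. by rewrite -rnormN opprB. Qed.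

Lemma rnorm_sum (V : normedZmodType C) (J : Type) (r : seq J) (P : pred J)
    (F : J -> V) :
  rnorm (\sum_(j <- r | P j) F j) <= \sum_(j <- r | P j) rnorm (F j).
Proof.
elim/big_rec2: _ => [|j y z _ h]; first by rewrite rnorm0.
by apply: le_trans (rnormD _ _) _; rewrite lerD2l.
Qed.

Lemma rnormZ (V : normedModType C) (a : C) (x : V) :
  rnorm (a *: x) = rnorm a * rnorm x.
Proof. by apply: complexI; rewrite rmorphM /= -!rnormE normrZ. Qed.

Lemma rnorm_conj (z : C) : rnorm z^* = rnorm z.
Proof. by rewrite /rnorm norm_conjC. Qed.

Lemma rnorm_real (t : R) : rnorm (toC t) = `|t|.
Proof. by rewrite /rnorm normc_def /= expr0n /= addr0 sqrtr_sqr. Qed.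

Lemma rnorm_nat n : rnorm (n%:R : C) = n%:R.
Proof. by rewrite -(rmorph_nat toC) rnorm_real normr_nat. Qed.

Lemma rnorm_half : rnorm (2^-1 : C) = 2^-1.
Proof. by rewrite -(rmorph_nat toC) -fmorphV rnorm_real ger0_norm. Qed.

Lemma rnorm_i : rnorm ('i : C) = 1.
Proof. by rewrite /rnorm normCi. Qed.

Lemma mulC_conj (z : C) : z * z^* = toC (rnorm z ^+ 2).
Proof. by rewrite -normCK rnormE rmorphXn. Qed.

Lemma ge0_toC (z : C) : 0 <= z -> z = toC (complex.Re z).
Proof. by move=> z0; rewrite RRe_real // ger0_real. Qed.

Lemma cReD (x y : C) : complex.Re (x + y) = complex.Re x + complex.Re y.
Proof. by case: x; case: y. Qed.

Lemma cReN (x : C) : complex.Re (- x) = - complex.Re x.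
Proof. by case: x. Qed.

Lemma cReB (x y : C) : complex.Re (x - y) = complex.Re x - complex.Re y.
Proof. by rewrite cReD cReN. Qed.

Lemma cRe_sum (J : Type) (r : seq J) (P : pred J) (F : J -> C) :
  complex.Re (\sum_(j <- r | P j) F j) = \sum_(j <- r | P j) complex.Re (F j).
Proof. by elim/big_rec2: _ => // j y z _ <-; rewrite cReD. Qed.

Lemma cReMr (t : R) (z : C) : complex.Re (toC t * z) = t * complex.Re z.
Proof. by case: z => a b /=; rewrite mul0r subr0. Qed.

Lemma cRe_conj (z : C) : complex.Re z^* = complex.Re z.
Proof.
have /(congr1 (@complex.Re R)) := addcJ z.
by case: z => a b /=.
Qed.

Lemma Re_le_rnorm (z : C) : complex.Re z <= rnorm z.
Proof.
rewrite -lecR -rnormE; apply: le_trans (normc_ge_Re z).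
by rewrite lecR ler_norm.
Qed.

Lemma rnorm_ge0E (z : C) : 0 <= z -> rnorm z = complex.Re z.
Proof. by move=> z0; rewrite /rnorm ger0_norm. Qed.

Lemma rnorm_eq (z w : C) : (forall e, 0 < e -> rnorm (z - w) < e) -> z = w.
Proof.
move=> h; apply/eqP; rewrite -subr_eq0 -rnorm_eq0; apply/eqP/le_anti.
by rewrite rnorm_ge0 andbT; apply/ler_addgt0Pl => e /h /ltW; rewrite addr0.
Qed.

Lemma rnorm_le_ReIm (z : C) : rnorm z <= `|complex.Re z| + `|complex.Im z|.
Proof.
rewrite {1}[z]complexE; apply: le_trans (rnormD _ _) _.
by rewrite rnormM !rnorm_real complexiE rnorm_i mul1r.
Qed.

Lemma Im_le_rnorm (z : C) : `|complex.Im z| <= rnorm z.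
Proof.
have := normc_ge_Re (z * 'i%C).
by rewrite ReiNIm normrN rnormE lecR rnormM complexiE rnorm_i mulr1.
Qed.

Lemma absRe_le_rnorm (z : C) : `|complex.Re z| <= rnorm z.
Proof. by rewrite -lecR -rnormE normc_ge_Re. Qed.

Lemma rnorm_double (z : C) : rnorm (z + z) = 2 * rnorm z.
Proof.
have -> : z + z = 2 * z by ring.
by rewrite rnormM rnorm_nat.
Qed.

End ComplexModulus.

Section ComplexLimits.
Context {R : realType}.
Local Notation C := R[i].
Local Notation toC := (real_complex R).

(** One notion for both limits that occur: along the finite subsets of [I] ([totally]) and along an
    ultrafilter on the indices [m]. *)
Definition fcvg (T : Type) (F : set_system T) (u : T -> C) (l : C) : Prop :=
  forall e : R, 0 < e -> F [set t | rnorm (u t - l) < e].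

Section Filter.
Context (T : Type) (F : set_system T) {FF : ProperFilter F}.
Implicit Types (u v : T -> C).

Lemma fcvg_uniq u k l : fcvg F u k -> fcvg F u l -> k = l.
Proof.
move=> uk ul; apply: rnorm_eq => e e0.
have e20 : 0 < e / 2 by rewrite divr_gt0.
have [t [/= tk tl]] := filter_ex (filterI (uk _ e20) (ul _ e20)).
rewrite (_ : k - l = (u t - l) - (u t - k)); last by ring.
by apply: le_lt_trans (rnormD _ _) _; rewrite rnormN; lra.
Qed.

Lemma fcvg_cst k : fcvg F (fun=> k) k.
Proof.
by move=> e e0; apply: filterE => t /=; rewrite subrr rnorm0.
Qed.

Lemma fcvg_null u v k (b : T -> R) :
  fcvg F v k -> F [set t | rnorm (u t - v t) <= b t] ->
  (forall e : R, 0 < e -> F [set t | b t < e]) -> fcvg F u k.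
Proof.
move=> vk uv b0 e e0.
have e20 : 0 < e / 2 by rewrite divr_gt0.
apply: (filterS _ (filterI uv (filterI (vk _ e20) (b0 _ e20)))) => t /=.
move=> [h1 [h2 h3]]; rewrite (_ : u t - k = (u t - v t) + (v t - k)); last by ring.
by apply: le_lt_trans (rnormD _ _) _; lra.
Qed.

Lemma fcvg_eq u v k : fcvg F v k -> u =1 v -> fcvg F u k.
Proof. by move=> vk uv e /vk; apply: filterS => t /=; rewrite uv. Qed.

Lemma fcvgD u v k l :
  fcvg F u k -> fcvg F v l -> fcvg F (fun t => u t + v t) (k + l).
Proof.
move=> uk vl e e0.
have e20 : 0 < e / 2 by rewrite divr_gt0.
apply: (filterS _ (filterI (uk _ e20) (vl _ e20))) => t /= [h1 h2].
rewrite (_ : _ - _ = (u t - k) + (v t - l)); last by ring.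
by apply: le_lt_trans (rnormD _ _) _; lra.
Qed.

Lemma fcvgZ a u k : fcvg F u k -> fcvg F (fun t => a * u t) (a * k).
Proof.
move=> uk e e0; have a0 := rnorm_ge0 a.
have e20 : 0 < e / (rnorm a + 1) by rewrite divr_gt0 // ltr_wpDl.
apply: (filterS _ (uk _ e20)) => t /=.
rewrite -mulrBr rnormM ltr_pdivlMr ?ltr_wpDl // => h.
by have := rnorm_ge0 (u t - k); nra.
Qed.

Lemma fcvgN u k : fcvg F u k -> fcvg F (fun t => - u t) (- k).
Proof.
by move=> uk e e0; apply: (filterS _ (uk e e0)) => t /=; rewrite -opprD rnormN.
Qed.

Lemma fcvg_conj u k : fcvg F u k -> fcvg F (fun t => (u t)^*) k^*.
Proof.
by move=> uk e e0; apply: (filterS _ (uk e e0)) => t /=; rewrite -rmorphB rnorm_conj.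
Qed.

Lemma fcvg_sum (J : Type) (r : seq J) (u : J -> T -> C) (k : J -> C) :
  (forall j, fcvg F (u j) (k j)) ->
  fcvg F (fun t => \sum_(j <- r) u j t) (\sum_(j <- r) k j).
Proof.
move=> uk; elim: r => [|j r ih].
  by rewrite big_nil; apply: fcvg_eq (fcvg_cst 0) _ => t; rewrite big_nil.
rewrite big_cons; apply: fcvg_eq (fcvgD (uk j) ih) _ => t.
by rewrite big_cons.
Qed.

Lemma fcvg_Re_le u k c :
  fcvg F u k -> F [set t | complex.Re (u t) <= c] -> complex.Re k <= c.
Proof.
move=> uk uc; apply/ler_addgt0Pl => e e0.
have [t [/= h1 h2]] := filter_ex (filterI uc (uk _ e0)).
have := Re_le_rnorm (k - u t); rewrite cReB rnormB; lra.
Qed.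

Lemma fcvg_ge0 u k : fcvg F u k -> F [set t | 0 <= u t] -> 0 <= k.
Proof.
move=> uk u0.
(* [0 <= k] in [C] includes that [k] is real, which has to pass to the limit before the sign
   does. *)
have kr : k = toC (complex.Re k).
  apply: rnorm_eq => e e0; have e20 : 0 < e / 2 by rewrite divr_gt0.
  have [t [/= /ge0_toC h1 h2]] := filter_ex (filterI u0 (uk _ e20)).
  rewrite (_ : k - _ = - (u t - k) + (u t - toC (complex.Re k))); last by ring.
  apply: le_lt_trans (rnormD _ _) _; rewrite rnormN {2}h1 -rmorphB rnorm_real.
  by rewrite -cReB; have := absRe_le_rnorm (u t - k); lra.
rewrite kr ler0c -oppr_le0 -cReN.
apply: (fcvg_Re_le (fcvgN uk)); apply: (filterS _ u0) => t /= ut0.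
by rewrite cReN oppr_le0 -ler0c -ge0_toC.
Qed.

Lemma fcvg_rnorm_le u k c :
  fcvg F u k -> F [set t | rnorm (u t) <= c] -> rnorm k <= c.
Proof.
move=> uk uc; apply/ler_addgt0Pl => e e0.
have [t [/= h1 h2]] := filter_ex (filterI uc (uk _ e0)).
rewrite (_ : k = u t - (u t - k)); last by ring.
by apply: le_trans (rnormD _ _) _; rewrite rnormN; lra.
Qed.

End Filter.

Lemma ultra_cvg_real (T : Type) (U : set_system T) {UU : UltraFilter U}
    (u : T -> R) (M : R) :
  (forall t, `|u t| <= M) ->
  exists l : R, forall e : R, 0 < e -> U [set t | `|u t - l| < e].
Proof.
move=> uM; have UP : ProperFilter (u @ U) by apply: fmap_proper_filter.
have [|l [_ cl]] := @segment_compact R (- M) M (u @ U) UP.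
  suff h : U [set t | u t \in `[- M, M]] by exact: h.
  by apply: filterE => t /=; rewrite in_itv /= -ler_norml.
exists l => e e0.
(* An ultrafilter contains this set or its complement; the complement would keep the cluster point
   [l] at distance [e]. *)
have [//|Ue] := in_ultra_setVsetC [set t | `|u t - l| < e] UU.
have [] := cl [set y | ~ `|y - l| < e] [set y | `|y - l| < e] Ue _.
  by apply/nbhs_ballP; exists e => // y /=; rewrite /ball /= distrC.
by move=> y [].
Qed.

Lemma ultra_fcvg (T : Type) (U : set_system T) {UU : UltraFilter U}
    (u : T -> C) (M : R) :
  (forall t, rnorm (u t) <= M) -> exists l, fcvg U u l.
Proof.
move=> uM.
have [t|a ha] := @ultra_cvg_real T U UU (fun t => complex.Re (u t)) M.
  exact: le_trans (absRe_le_rnorm _) (uM t).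
have [t|b hb] := @ultra_cvg_real T U UU (fun t => complex.Im (u t)) M.
  exact: le_trans (Im_le_rnorm _) (uM t).
exists (Complex a b) => e e0; have e20 : 0 < e / 2 by rewrite divr_gt0.
apply: (filterS _ (filterI (ha _ e20) (hb _ e20))) => t /= [h1 h2].
apply: le_lt_trans (rnorm_le_ReIm _) _.
by case: (u t) h1 h2 => x y /=; lra.
Qed.

End ComplexLimits.

(** * Inner products and norms of matrices *)

Section InnerProducts.
Context {R : realType}.
Local Notation C := R[i].
Local Notation toC := (real_complex R).

(** Only positive semidefinite: this condition survives limits, whereas definiteness of the limit
    form comes at the end, from the lower bound ([S_definite]). *)
Definition inner_product (V : lmodType C) (D : V -> V -> C) : Prop :=
  [/\ forall a x y z, D (a *: x + y) z = a * D x z + D y z,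
      forall x y, D y x = (D x y)^*
    & forall x, 0 <= D x x].

Section Theory.
Context (V : lmodType C) (D : V -> V -> C) (ipD : inner_product D).

Definition sqnorm (x : V) : R := complex.Re (D x x).
Definition ipnorm (x : V) : R := Num.sqrt (sqnorm x).

Lemma ipC x y : D y x = (D x y)^*.
Proof. by case: ipD. Qed.

Lemma ipDl x y z : D (x + y) z = D x z + D y z.
Proof. by case: ipD => h _ _; rewrite -[x in LHS]scale1r h mul1r. Qed.

Lemma ip0l z : D 0 z = 0.
Proof. by apply: (addrI (D 0 z)); rewrite -ipDl !addr0. Qed.

Lemma ipZl a x z : D (a *: x) z = a * D x z.
Proof. by case: ipD => h _ _; rewrite -[a *: x]addr0 h ip0l addr0. Qed.

Lemma ipNl x z : D (- x) z = - D x z.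
Proof. by rewrite -scaleN1r ipZl mulN1r. Qed.

Lemma ipBl x y z : D (x - y) z = D x z - D y z.
Proof. by rewrite ipDl ipNl. Qed.

Lemma ipDr x y z : D z (x + y) = D z x + D z y.
Proof. by rewrite ipC ipDl rmorphD /= -!ipC. Qed.

Lemma ip0r z : D z 0 = 0.
Proof. by rewrite ipC ip0l rmorph0. Qed.

Lemma ipZr a x z : D z (a *: x) = a^* * D z x.
Proof. by rewrite ipC ipZl rmorphM /= -ipC. Qed.

Lemma ipNr x z : D z (- x) = - D z x.
Proof. by rewrite ipC ipNl rmorphN /= -ipC. Qed.

Lemma ip_suml (J : Type) (r : seq J) (P : pred J) (F : J -> V) z :
  D (\sum_(j <- r | P j) F j) z = \sum_(j <- r | P j) D (F j) z.
Proof. by elim/big_rec2: _ => [|j y w _ <-]; rewrite ?ip0l ?ipDl. Qed.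

Lemma ip_sumr (J : Type) (r : seq J) (P : pred J) (F : J -> V) z :
  D z (\sum_(j <- r | P j) F j) = \sum_(j <- r | P j) D z (F j).
Proof. by elim/big_rec2: _ => [|j y w _ <-]; rewrite ?ip0r ?ipDr. Qed.

Lemma sqnormE x : D x x = toC (sqnorm x).
Proof. by apply: ge0_toC; case: ipD. Qed.

Lemma sqnorm_ge0 x : 0 <= sqnorm x.
Proof. by rewrite -ler0c -sqnormE; case: ipD. Qed.

Lemma sqnorm0 : sqnorm 0 = 0.
Proof. by rewrite /sqnorm ip0l. Qed.

Lemma sqnormZ a x : sqnorm (a *: x) = rnorm a ^+ 2 * sqnorm x.
Proof. by rewrite {1}/sqnorm ipZl ipZr mulrA mulC_conj cReMr. Qed.

Lemma sqnormN x : sqnorm (- x) = sqnorm x.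
Proof. by rewrite /sqnorm ipNl ipNr opprK. Qed.

Lemma sqnormD x y :
  sqnorm (x + y) = sqnorm x + sqnorm y + 2 * complex.Re (D x y).
Proof.
rewrite /sqnorm !ipDl !ipDr !cReD [D y x]ipC cRe_conj; ring.
Qed.

Lemma sqnormD_le x y : sqnorm (x + y) <= 2 * sqnorm x + 2 * sqnorm y.
Proof.
have := sqnorm_ge0 (x - y); rewrite !sqnormD sqnormN ipNr cReN; lra.
Qed.

Lemma cauchy_schwarz_sqr x y : rnorm (D x y) ^+ 2 <= sqnorm x * sqnorm y.
Proof.
set d := D x y; set m := rnorm d ^+ 2.
have m0 : 0 <= m by exact: sqr_ge0.
(* Expand the square norm of [x - t * d *: y] for real [t]; the minimum over [t] is the claim. *)
have key (t : R) : 0 <= sqnorm x - 2 * t * m + t ^+ 2 * m * sqnorm y.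
  have := sqnorm_ge0 (x + (- (toC t * d)) *: y).
  rewrite sqnormD sqnormZ rnormN rnormM rnorm_real ipZr rmorphN rmorphM /=.
  rewrite conj_Creal ?complex_real // mulNr cReN -mulrA cReMr -/d mulrC.
  rewrite [X in t * complex.Re X]mulrC mulC_conj /= -/m exprMn real_normK ?num_real //.
  by congr (0 <= _); rewrite -/m; ring.
have := sqnorm_ge0 y; rewrite le_eqVlt => /orP[/eqP y0|y0]; last first.
  have := key (sqnorm y)^-1.
  rewrite -(ler_pM2r y0) mul0r (_ : (_ - _ + _) * _ = sqnorm x * sqnorm y - m) ?subr_ge0 //.
  by field; rewrite gt_eqF.
(* For a null vector [y] the bound [key] is affine in [t], and a large [t] forces [m <= e]. *)
rewrite -y0 mulr0; apply/ler_addgt0Pl => e e0; rewrite addr0.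
have x0 := sqnorm_ge0 x.
have := key ((sqnorm x + 1) / (2 * e)); rewrite -y0 mulr0 addr0.
rewrite (_ : 2 * _ * m = (sqnorm x + 1) * m / e); last by field; rewrite gt_eqF.
rewrite subr_ge0 ler_pdivrMr // => h; nra.
Qed.

Lemma ipnorm_ge0 x : 0 <= ipnorm x.
Proof. exact: sqrtr_ge0. Qed.

Lemma ipnorm_sqr x : ipnorm x ^+ 2 = sqnorm x.
Proof. by rewrite sqr_sqrtr ?sqnorm_ge0. Qed.

Lemma ipnorm0 : ipnorm 0 = 0.
Proof. by rewrite /ipnorm sqnorm0 sqrtr0. Qed.

Lemma ipnormZ a x : ipnorm (a *: x) = rnorm a * ipnorm x.
Proof.
by rewrite /ipnorm sqnormZ sqrtrM ?sqr_ge0 // sqrtr_sqr ger0_norm ?rnorm_ge0.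
Qed.

Lemma ipnormN x : ipnorm (- x) = ipnorm x.
Proof. by rewrite /ipnorm sqnormN. Qed.

Lemma cauchy_schwarz x y : rnorm (D x y) <= ipnorm x * ipnorm y.
Proof.
rewrite -(@ler_pXn2r _ 2) ?nnegrE ?mulr_ge0 ?ipnorm_ge0 ?rnorm_ge0 //.
by rewrite exprMn !ipnorm_sqr cauchy_schwarz_sqr.
Qed.

Lemma ipnormD x y : ipnorm (x + y) <= ipnorm x + ipnorm y.
Proof.
rewrite -(@ler_pXn2r _ 2) ?nnegrE ?addr_ge0 ?ipnorm_ge0 //.
rewrite ipnorm_sqr sqnormD -!ipnorm_sqr.
have := cauchy_schwarz x y; have := Re_le_rnorm (D x y); nra.
Qed.

Lemma ipnormB x y : ipnorm (x - y) <= ipnorm x + ipnorm y.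
Proof. by apply: le_trans (ipnormD _ _) _; rewrite ipnormN. Qed.

Lemma ipnorm_sum (J : Type) (r : seq J) (P : pred J) (F : J -> V) :
  ipnorm (\sum_(j <- r | P j) F j) <= \sum_(j <- r | P j) ipnorm (F j).
Proof.
elim/big_rec2: _ => [|j y z _ h]; first by rewrite ipnorm0.
by apply: le_trans (ipnormD _ _) _; rewrite lerD2l.
Qed.

End Theory.
End InnerProducts.

Section OperatorNorms.
Context {R : realType}.
Local Notation C := R[i].
Local Notation toC := (real_complex R).

(** The scaling is a parameter so that the same bounds serve scalars, vectors of [H] and columns
    over [H], which are scaled entrywise. *)
Definition homogeneous (V : Type) (sc : C -> V -> V) (N : V -> R) : Prop :=
  (forall x, 0 <= N x) /\ (forall a x, N (sc a x) = rnorm a * N x).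

Section Generic.
Context (V W : Type) (scV : C -> V -> V) (scW : C -> W -> W) (x0 : V).
Context (NV : V -> R) (NW : W -> R).
Context (sV : homogeneous scV NV) (sW : homogeneous scW NW).
Context (T : V -> W) (TZ : forall a x, T (scV a x) = scW a (T x)).

Lemma opnorm_le c : 0 <= c -> (forall x, NW (T x) <= c * NV x) ->
  opnorm NV NW T <= c.
Proof.
move=> c0 h; apply: ge_sup.
  by exists (NW (T (scV 0 x0))); exists (scV 0 x0) => //=; rewrite sV.2 rnorm0 mul0r.
move=> _ [x /= x1 <-]; apply: le_trans (h x) _.
by rewrite -[leRHS]mulr1 ler_wpM2l.
Qed.

Context (M : R) (TM : forall x, NW (T x) <= M * NV x).

(** A [sup] is a default value on an unbounded set; the crude bound [M] rules this out. *)
Lemma opnorm_has_sup : has_sup [set NW (T x) | x in [set x | NV x <= 1]].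
Proof.
split.
  by exists (NW (T (scV 0 x0))); exists (scV 0 x0) => //=; rewrite sV.2 rnorm0 mul0r.
exists `|M| => _ [x /= x1 <-]; apply: le_trans (TM x) _.
rewrite -[leRHS]mulr1; apply: le_trans (ler_wpM2l (normr_ge0 M) x1).
by rewrite ler_wpM2r ?sV.1 // ler_norm.
Qed.

Lemma opnorm_ge0 : 0 <= opnorm NV NW T.
Proof.
apply: le_trans (sW.1 (T (scV 0 x0))) _; apply: ub_le_sup.
  exact: opnorm_has_sup.2.
by exists (scV 0 x0) => //=; rewrite sV.2 rnorm0 mul0r.
Qed.

Lemma opnormP x : NW (T x) <= opnorm NV NW T * NV x.
Proof.
have := sV.1 x; rewrite le_eqVlt => /orP[/eqP x00|xp].
  by apply: le_trans (TM x) _; rewrite -x00 !mulr0.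
rewrite -ler_pdivrMr //; apply: ub_le_sup; first exact: opnorm_has_sup.2.
have rn : rnorm (toC (NV x)^-1) = (NV x)^-1.
  by rewrite rnorm_real ger0_norm // invr_ge0 ltW.
exists (scV (toC (NV x)^-1) x) => /=.
  by rewrite sV.2 rn mulVf // gt_eqF.
by rewrite TZ sW.2 rn mulrC.
Qed.

End Generic.

(** Columns are taken as finite functions, which inherit the module structure of [V] pointwise. *)
Definition col_ip (V : lmodType C) (D : V -> V -> C) n
    (x y : {ffun 'I_n -> V}) : C :=
  \sum_i D (x i) (y i).

Lemma col_inner_product (V : lmodType C) (D : V -> V -> C) n :
  inner_product D -> inner_product (@col_ip V D n).
Proof.
move=> ipD; split.
- move=> a x y z; rewrite /col_ip mulr_sumr -big_split /=.
  by apply: eq_bigr => i _; rewrite !ffunE; case: ipD => ->.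
- move=> x y; rewrite /col_ip rmorph_sum; apply: eq_bigr => i _.
  exact: ipC.
- by move=> x; apply: sumr_ge0 => i _; case: ipD.
Qed.

Definition scalar_ip (x y : C) : C := x * y^*.

Lemma scalar_inner_product : inner_product (R := R) (V := C^o) scalar_ip.
Proof.
split.
- by move=> a x y z; rewrite /scalar_ip mulrDl mulrA.
- by move=> x y; rewrite /scalar_ip rmorphM /= conjCK mulrC.
- by move=> x; rewrite /scalar_ip mulC_conj ler0c sqr_ge0.
Qed.

Lemma l2norm_ge0 (V : normedZmodType C) n (x : 'cV[V]_n) : 0 <= l2norm x.
Proof. exact: sqrtr_ge0. Qed.

Lemma l2norm_sqr (V : normedZmodType C) n (x : 'cV[V]_n) :
  l2norm x ^+ 2 = \sum_i rnorm (x i 0) ^+ 2.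
Proof. by rewrite sqr_sqrtr // sumr_ge0 // => i _; rewrite sqr_ge0. Qed.

Section ColumnNorms.
Context (V : normedModType C) (D : V -> V -> C) (ipD : inner_product D).
Context (DE : forall x, D x x = `|x| ^+ 2).

Definition colf n (x : 'cV[V]_n) : {ffun 'I_n -> V} := [ffun i => x i 0].

Lemma l2norm_ip n (x : 'cV[V]_n) : l2norm x = ipnorm (@col_ip V D n) (colf x).
Proof.
rewrite /l2norm /ipnorm {1}/sqnorm /col_ip cRe_sum; congr Num.sqrt.
by apply: eq_bigr => i _; rewrite ffunE DE rnormE -rmorphXn.
Qed.

Lemma l2normZ n a (x : 'cV[V]_n) :
  l2norm (\col_i (a *: x i 0)) = rnorm a * l2norm x.
Proof.
rewrite !l2norm_ip -(ipnormZ (col_inner_product n ipD)).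
by congr ipnorm; apply/ffunP => i; rewrite !ffunE mxE.
Qed.

Lemma l2norm_homogeneous n :
  homogeneous (fun a (x : 'cV[V]_n) => \col_i (a *: x i 0)) (@l2norm R V n).
Proof. by split; [exact: l2norm_ge0|exact: l2normZ]. Qed.

Lemma l2normD n (x y : 'cV[V]_n) : l2norm (x + y) <= l2norm x + l2norm y.
Proof.
rewrite !l2norm_ip (_ : colf (x + y) = colf x + colf y).
  exact: (ipnormD (col_inner_product n ipD)).
by apply/ffunP => i; rewrite !ffunE mxE.
Qed.

Lemma l2norm_cs n (x y : 'cV[V]_n) :
  rnorm (\sum_i D (x i 0) (y i 0)) <= l2norm x * l2norm y.
Proof.
rewrite !l2norm_ip; have := cauchy_schwarz (col_inner_product n ipD) (colf x) (colf y).
by rewrite {1}/col_ip; under eq_bigr do rewrite !ffunE.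
Qed.

End ColumnNorms.

Lemma rnorm_le_l2norm (V : normedZmodType C) n (x : 'cV[V]_n) i :
  rnorm (x i 0) <= l2norm x.
Proof.
rewrite -(@ler_pXn2r _ 2) ?nnegrE ?rnorm_ge0 ?l2norm_ge0 // l2norm_sqr.
by rewrite (bigD1 i) //= lerDl sumr_ge0 // => j _; rewrite sqr_ge0.
Qed.

Lemma l2norm_le_sum (V : normedZmodType C) n (x : 'cV[V]_n) :
  l2norm x <= \sum_i rnorm (x i 0).
Proof.
have s0 : 0 <= \sum_i rnorm (x i 0) by apply: sumr_ge0 => i _; exact: rnorm_ge0.
rewrite -(@ler_pXn2r _ 2) ?nnegrE ?l2norm_ge0 // l2norm_sqr expr2 mulr_suml.
apply: ler_sum => i _; rewrite expr2 ler_wpM2l ?rnorm_ge0 //.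
by rewrite (bigD1 i) //= lerDl sumr_ge0 // => j _; exact: rnorm_ge0.
Qed.

Lemma l2norm_mulmx_le n (A : 'M[C]_n) (v : 'cV[C]_n) :
  l2norm (A *m v) <= (\sum_i \sum_j rnorm (A i j)) * l2norm v.
Proof.
apply: le_trans (l2norm_le_sum _) _; rewrite mulr_suml.
apply: ler_sum => i _; rewrite mxE; apply: le_trans (rnorm_sum _ _ _) _.
rewrite mulr_suml; apply: ler_sum => j _; rewrite rnormM.
by rewrite ler_wpM2l ?rnorm_ge0 ?rnorm_le_l2norm.
Qed.

Lemma scalar_ipE (x : C^o) : scalar_ip x x = `|x| ^+ 2.
Proof. by rewrite /scalar_ip -normCK. Qed.

Local Notation homC := (l2norm_homogeneous scalar_inner_product scalar_ipE).

Lemma l2normD_scalar n (x y : 'cV[C]_n) : l2norm (x + y) <= l2norm x + l2norm y.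
Proof. by apply: le_trans (l2normD scalar_inner_product scalar_ipE x y) _. Qed.

Lemma l2normZ_scalar n a (x : 'cV[C]_n) : l2norm (a *: x) = rnorm a * l2norm x.
Proof.
rewrite -(l2normZ scalar_inner_product scalar_ipE).
by congr l2norm; apply/colP => i; rewrite !mxE.
Qed.

Lemma l2norm_cs_scalar n (x y : 'cV[C]_n) :
  rnorm (\sum_i x i 0 * (y i 0)^*) <= l2norm x * l2norm y.
Proof. by apply: le_trans (l2norm_cs scalar_inner_product scalar_ipE x y) _. Qed.

Lemma cmxnormP n (A : 'M[C]_n) (v : 'cV[C]_n) :
  l2norm (A *m v) <= cmxnorm A * l2norm v.
Proof.
apply: (opnormP 0 (homC n) (homC n) _ (@l2norm_mulmx_le n A)).
move=> a x; apply/colP => i; rewrite !mxE [RHS]mulr_sumr.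
by apply: eq_bigr => j _; rewrite mxE; exact: mulrCA.
Qed.

Lemma cmxnorm_ge0 n (A : 'M[C]_n) : 0 <= cmxnorm A.
Proof. exact: (opnorm_ge0 0 (homC n) (homC n) (@l2norm_mulmx_le n A)). Qed.

Lemma cmxnorm_le n (A : 'M[C]_n) c : 0 <= c ->
  (forall v, l2norm (A *m v) <= c * l2norm v) -> cmxnorm A <= c.
Proof. exact: (opnorm_le 0 (homC n)). Qed.

Lemma cmxnormD n (A B : 'M[C]_n) : cmxnorm (A + B) <= cmxnorm A + cmxnorm B.
Proof.
apply: cmxnorm_le; first by rewrite addr_ge0 ?cmxnorm_ge0.
move=> v; rewrite mulmxDl mulrDl.
by apply: le_trans (l2normD_scalar _ _) _; rewrite lerD ?cmxnormP.
Qed.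

Lemma cmxnorm_le_sum n (A : 'M[C]_n) : cmxnorm A <= \sum_i \sum_j rnorm (A i j).
Proof.
apply: cmxnorm_le; last exact: l2norm_mulmx_le.
by apply: sumr_ge0 => i _; apply: sumr_ge0 => j _; exact: rnorm_ge0.
Qed.

(** Continuity of the norm in the entries. The crude constant is harmless, because the size is fixed
    whenever the entries tend to a limit. *)
Lemma cmxnorm_dist n (A B : 'M[C]_n) :
  `|cmxnorm A - cmxnorm B| <= \sum_i \sum_j rnorm (A i j - B i j).
Proof.
have half (E F : 'M[C]_n) :
    cmxnorm E - cmxnorm F <= \sum_i \sum_j rnorm (E i j - F i j).
  rewrite lerBlDr -[E in leLHS](subrK F); apply: le_trans (cmxnormD _ _) _.
  rewrite lerD2r; apply: le_trans (cmxnorm_le_sum _) _.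
  by apply: ler_sum => i _; apply: ler_sum => j _; rewrite !mxE.
rewrite ler_norml half andbT lerNl opprB; apply: le_trans (half _ _) _.
by apply: ler_sum => i _; apply: ler_sum => j _; rewrite rnormB.
Qed.

Definition mxform n (A : 'M[C]_n) (v w : 'cV[C]_n) : C :=
  \sum_i \sum_j A i j * v j 0 * (w i 0)^*.

Lemma mxform_le n (A : 'M[C]_n) v w :
  rnorm (mxform A v w) <= cmxnorm A * (l2norm v * l2norm w).
Proof.
rewrite (_ : mxform A v w = \sum_i (A *m v) i 0 * (w i 0)^*); last first.
  by apply: eq_bigr => i _; rewrite mxE mulr_suml.
apply: le_trans (l2norm_cs_scalar _ _) _.
by rewrite mulrA ler_wpM2r ?l2norm_ge0 // cmxnormP.
Qed.

(** Test with [w = A *m v], where the form is the square of the norm of [A *m v]. *)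
Lemma cmxnorm_mxform n (A : 'M[C]_n) c : 0 <= c ->
  (forall v w, rnorm (mxform A v w) <= c * (l2norm v * l2norm w)) ->
  cmxnorm A <= c.
Proof.
move=> c0 h; apply: cmxnorm_le => // v; set u := A *m v.
have [u0|u0] := eqVneq (l2norm u) 0.
  by rewrite u0 mulr_ge0 ?l2norm_ge0.
have up : 0 < l2norm u by rewrite lt_def u0 l2norm_ge0.
have := h v u; rewrite (_ : mxform A v u = toC (l2norm u ^+ 2)).
  rewrite rnorm_real ger0_norm ?sqr_ge0 // expr2 mulrA ler_pM2r //.
rewrite l2norm_sqr rmorph_sum; apply: eq_bigr => i _.
by rewrite -mulr_suml; transitivity (u i 0 * (u i 0)^*);
  [congr (_ * _); rewrite /u mxE|exact: mulC_conj].
Qed.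

End OperatorNorms.

(** * The quadratic forms behind the operator Hilbert space norm *)

Section PositiveForms.
Context {R : realType}.
Local Notation C := R[i].
Local Notation toC := (real_complex R).

Definition hsnorm n (V : 'M[C]_n) : R :=
  Num.sqrt (\sum_i \sum_j rnorm (V i j) ^+ 2).

Definition outer n p (A : 'M[C]_(n, p)) : 'M[C]_n :=
  \matrix_(i, j) \sum_s A i s * (A j s)^*.

(** If [D (x k l) (x k' l')] is the sum over [i] of [a_i k l] times the conjugate of [a_i k' l'],
    this is the Hilbert-Schmidt inner product of [sum_i a_i V a_i^*] with [W]. Hence the square of
    the norm in Pisier's formula is the norm of a completely positive map on the Hilbert-Schmidt
    matrices. *)
Definition oform (T : Type) (D : T -> T -> C) n (x : 'M[T]_n) (V W : 'M[C]_n) : C :=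
  \sum_k \sum_k' \sum_l \sum_l' D (x k l) (x k' l') * V l l' * (W k k')^*.

(* Testing only positive semidefinite matrices, which are those of the form
   [outer A], makes monotonicity and the parallelogram inequality immediate,
   because there the form is a sum of squares ([oform_outer]); it loses at most
   a factor 16 on the norm ([ohle_cmxnorm]). *)
Definition ohle (T : Type) (D : T -> T -> C) n (x : 'M[T]_n) (c : R) : Prop :=
  forall p q (A : 'M[C]_(n, p)) (B : 'M[C]_(n, q)),
    complex.Re (oform D x (outer A) (outer B))
      <= c * (hsnorm (outer A) * hsnorm (outer B)).

Definition unflat n (v : 'cV[C]_(n * n)) : 'M[C]_n :=
  \matrix_(i, j) v (mxtens_index (i, j)) 0.

Definition flat n (V : 'M[C]_n) : 'cV[C]_(n * n) :=
  \col_p V (mxtens_unindex p).1 (mxtens_unindex p).2.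

(** For the inner product of l_2(I) this is the matrix [sum_i a_i (x) conj(a_i)] of Pisier's
    formula, expressed by inner products of entries without reference to a basis. *)
Definition gram (T : Type) (D : T -> T -> C) n (x : 'M[T]_n) : 'M[C]_(n * n) :=
  \matrix_(p, q) D (x (mxtens_unindex p).1 (mxtens_unindex q).1)
                   (x (mxtens_unindex p).2 (mxtens_unindex q).2).

Lemma sum_mxtens (V : nmodType) m n (F : 'I_(m * n) -> V) :
  \sum_p F p = \sum_i \sum_j F (mxtens_index (i, j)).
Proof.
rewrite pair_bigA /= (reindex (@mxtens_index m n)) /=; last first.
  by exists (@mxtens_unindex m n) => i _; rewrite (mxtens_indexK, mxtens_unindexK).
by apply: eq_bigr => -[i j] _.
Qed.

Lemma hsnorm_ge0 n (V : 'M[C]_n) : 0 <= hsnorm V.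
Proof. exact: sqrtr_ge0. Qed.

Lemma hsnorm_sqr n (V : 'M[C]_n) :
  hsnorm V ^+ 2 = \sum_i \sum_j rnorm (V i j) ^+ 2.
Proof.
rewrite sqr_sqrtr // sumr_ge0 // => i _; rewrite sumr_ge0 // => j _.
exact: sqr_ge0.
Qed.

Lemma hsnorm_flat n (V : 'M[C]_n) : hsnorm V = l2norm (flat V).
Proof.
rewrite /hsnorm /l2norm sum_mxtens; congr Num.sqrt.
by apply: eq_bigr => i _; apply: eq_bigr => j _; rewrite mxE mxtens_indexK.
Qed.

Lemma flatK n (v : 'cV[C]_(n * n)) : flat (unflat v) = v.
Proof. by apply/colP => p; rewrite !mxE -surjective_pairing mxtens_unindexK. Qed.

Lemma mxform_gram (T : Type) (D : T -> T -> C) n (x : 'M[T]_n) V W :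
  mxform (gram D x) (flat V) (flat W) = oform D x V W.
Proof.
rewrite /mxform sum_mxtens; apply: eq_bigr => k _; apply: eq_bigr => k' _.
rewrite sum_mxtens; apply: eq_bigr => l _; apply: eq_bigr => l' _.
by rewrite !mxE !mxtens_indexK.
Qed.

Lemma hsnormD n (V W : 'M[C]_n) : hsnorm (V + W) <= hsnorm V + hsnorm W.
Proof.
rewrite !hsnorm_flat (_ : flat (V + W) = flat V + flat W).
  exact: l2normD_scalar.
by apply/colP => i; rewrite !mxE.
Qed.

Lemma hsnormZ n a (V : 'M[C]_n) : hsnorm (a *: V) = rnorm a * hsnorm V.
Proof.
rewrite !hsnorm_flat -l2normZ_scalar.
by congr l2norm; apply/colP => i; rewrite !mxE.
Qed.

Lemma rnorm_le_hsnorm n (V : 'M[C]_n) i j : rnorm (V i j) <= hsnorm V.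
Proof.
rewrite hsnorm_flat; apply: le_trans (rnorm_le_l2norm _ (mxtens_index (i, j))).
by rewrite mxE mxtens_indexK.
Qed.

Lemma hsnorm_adj n (V : 'M[C]_n) : hsnorm (map_mx Num.conj V^T) = hsnorm V.
Proof.
rewrite /hsnorm exchange_big; congr Num.sqrt.
by apply: eq_bigr => i _; apply: eq_bigr => j _; rewrite !mxE rnorm_conj.
Qed.

Lemma hsnorm_trace n (V : 'M[C]_n) :
  toC (hsnorm V ^+ 2) = \tr (V *m map_mx Num.conj V^T).
Proof.
rewrite hsnorm_sqr rmorph_sum; apply: eq_bigr => i _.
rewrite mxE rmorph_sum; apply: eq_bigr => j _.
by rewrite !mxE; apply: esym; exact: mulC_conj.
Qed.

Local Open Scope sesquilinear_scope.

Lemma hsnorm_unitary_diag n (U : 'M[C]_n) (d : 'rV[C]_n) : U \is unitarymx ->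
  hsnorm (U^t* *m diag_mx d *m U) ^+ 2 = \sum_i rnorm (d 0 i) ^+ 2.
Proof.
move=> Uu; apply: complexI; rewrite hsnorm_trace.
rewrite !trmx_mul !map_mxM !mulmxA trmxCK [_ *m U *m _]mulmxtVK //.
rewrite mxtrace_mulC !mulmxA; have /unitarymxP -> := Uu.
rewrite mul1mx tr_diag_mx map_diag_mx mulmx_diag mxtrace_diag rmorph_sum.
by apply: eq_bigr => i _; rewrite !mxE; exact: mulC_conj.
Qed.

Lemma outer_unitary n (U : 'M[C]_n) (d : 'rV[C]_n) : (forall i, 0 <= d 0 i) ->
  outer (U^t* *m diag_mx (map_mx sqrtC d)) = U^t* *m diag_mx d *m U.
Proof.
move=> d0; apply/matrixP => i j; rewrite !mxE; apply: eq_bigr => s _.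
rewrite !mul_mx_diag !mxE rmorphM /=.
have -> : (sqrtC (d 0 s))^* = sqrtC (d 0 s).
  by apply/CrealP; rewrite ger0_real ?sqrtC_ge0.
rewrite mulrACA -expr2 sqrtCK [X in _ * X * _](_ : _ = U s j); last exact: conjCK.
by rewrite mulrAC.
Qed.

(** The positive and negative spectral parts: their eigenvalues are bounded in modulus by those of
    [A], and the Hilbert-Schmidt norm is the l_2 norm of the eigenvalues. *)
Lemma hermitian_decomposition n (A : 'M[C]_n) : A^t* = A ->
  exists P N : 'M[C]_n, [/\ A = outer P - outer N,
    hsnorm (outer P) <= hsnorm A & hsnorm (outer N) <= hsnorm A].
Proof.
move=> AA; have Ah : A \is hermsymmx.
  by apply/is_hermitianmxP; rewrite expr0 scale1r AA.
set U := spectralmx A; set d := spectral_diag A.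
have Uu : U \is unitarymx by exact: spectral_unitarymx.
have dr : d \is a realmx by exact: hermitian_spectral_diag_real.
have AE : A = U^t* *m diag_mx d *m U.
  by rewrite -invmx_unitary //; apply/orthomx_spectralP/hermitian_normalmx.
pose dp := map_mx (fun z : C => toC (Num.max (complex.Re z) 0)) d.
pose dn := map_mx (fun z => toC (Num.max (- complex.Re z) 0)) d.
have dp0 i : 0 <= dp 0 i by rewrite mxE ler0c le_max lexx orbT.
have dn0 i : 0 <= dn 0 i by rewrite mxE ler0c le_max lexx orbT.
have dE i : d 0 i = toC (complex.Re (d 0 i)).
  by rewrite RRe_real //; exact: (mxOverP dr).
have bound (e : 'rV[C]_n) : (forall i, rnorm (e 0 i) <= rnorm (d 0 i)) ->
    hsnorm (U^t* *m diag_mx e *m U) <= hsnorm A.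
  move=> ed; have hA := hsnorm_unitary_diag d Uu; rewrite -AE in hA.
  rewrite -(@ler_pXn2r _ 2) ?nnegrE ?hsnorm_ge0 // hA.
  have -> := hsnorm_unitary_diag e Uu; apply: ler_sum => i _.
  by rewrite ler_pXn2r ?nnegrE ?rnorm_ge0.
exists (U^t* *m diag_mx (map_mx sqrtC dp)), (U^t* *m diag_mx (map_mx sqrtC dn)).
rewrite !outer_unitary //; split.
- rewrite -mulmxBl -mulmxBr [LHS]AE; congr (_ *m _ *m _).
  apply/matrixP => i j; rewrite !mxE -mulrnBl; congr (_ *+ _).
  rewrite [LHS]dE -rmorphB; congr toC.
  by case: (leP (complex.Re (d 0 i)) 0); case: (leP (- complex.Re (d 0 i)) 0); lra.
- apply: bound => i; rewrite mxE rnorm_real dE rnorm_real.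
  by rewrite ger0_norm ?le_max ?lexx ?orbT // ge_max normr_ge0 ler_norm.
- apply: bound => i; rewrite mxE rnorm_real dE rnorm_real.
  by rewrite ger0_norm ?le_max ?lexx ?orbT // ge_max normr_ge0 -normrN ler_norm.
Qed.

End PositiveForms.

Section OhForms.
Context {R : realType}.
Local Notation C := R[i].
Local Notation toC := (real_complex R).
Local Open Scope sesquilinear_scope.

(** Cartesian decomposition followed by spectral parts: [b.1] chooses between [H1] and [H2], and
    [b.2] the sign. The norm does not grow because [H1] and [H2] are averages of matrices with the
    norm of [V]. *)
Lemma psd_decomposition n (V : 'M[C]_n) :
  exists (c : bool * bool -> C) (P : bool * bool -> 'M[C]_n),
    [/\ V = \sum_b c b *: outer (P b), forall b, rnorm (c b) = 1
      & forall b, hsnorm (outer (P b)) <= hsnorm V].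
Proof.
have half_norm (A B : 'M[C]_n) (a : C) : hsnorm A = hsnorm V ->
    hsnorm B = hsnorm V -> rnorm a = 1 -> hsnorm ((2^-1 * a) *: (A + B)) <= hsnorm V.
  move=> hA hB ha; rewrite hsnormZ rnormM ha mulr1.
  by rewrite rnorm_half; have := hsnormD A B; rewrite hA hB; lra.
have hadj (A : 'M[C]_n) : hsnorm (A^t*) = hsnorm A by exact: hsnorm_adj.
have adjZ (a : C) (A : 'M[C]_n) : (a *: A)^t* = a^* *: A^t*.
  by apply/matrixP => i j; rewrite !mxE rmorphM.
have adjD (A B : 'M[C]_n) : (A + B)^t* = A^t* + B^t*.
  by apply/matrixP => i j; rewrite !mxE rmorphD.
have adjN (A : 'M[C]_n) : (- A)^t* = - A^t*.
  by apply/matrixP => i j; rewrite !mxE rmorphN.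
have half_conj : (2^-1 : C)^* = 2^-1.
  by rewrite fmorphV rmorph_nat.
(* The factor 1 gives [H1] the same shape as [H2], so that [half_norm] covers both. *)
pose H1 := (2^-1 * 1 : C) *: (V + V^t*).
pose H2 := (2^-1 * - 'i : C) *: (V - V^t*).
have h1 : H1^t* = H1.
  by rewrite /H1 adjZ adjD trmxCK rmorphM /= half_conj rmorph1 addrC.
have h2 : H2^t* = H2.
  rewrite /H2 adjZ adjD adjN trmxCK rmorphM /= half_conj rmorphN /= conjCi opprK.
  by rewrite mulrN scaleNr -scalerN opprB.
have VE : V = H1 + 'i *: H2.
  rewrite /H1 /H2 scalerA [in X in _ + X]mulrCA mulrN -expr2 sqrCi opprK -scalerDr.
  by apply/matrixP => i j; rewrite !mxE; field.
have n1 : hsnorm H1 <= hsnorm V.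
  by apply: half_norm; rewrite ?hadj //; have := @rnorm_nat R 1.
have n2 : hsnorm H2 <= hsnorm V.
  apply: half_norm; rewrite ?rnormN ?rnorm_i //.
  by rewrite -scaleN1r hsnormZ rnormN (@rnorm_nat R 1) mul1r hadj.
have [P1 [N1 [E1 p1 m1]]] := hermitian_decomposition h1.
have [P2 [N2 [E2 p2 m2]]] := hermitian_decomposition h2.
exists (fun b => (if b.1 then 1 else 'i) * (if b.2 then 1 else -1)).
exists (fun b => if b.1 then (if b.2 then P1 else N1) else (if b.2 then P2 else N2)).
split.
- rewrite -(pair_bigA _ (fun b1 b2 => ((if b1 then 1 else 'i) * (if b2 then 1 else -1)) *:
    outer (if b1 then (if b2 then P1 else N1) else (if b2 then P2 else N2)))) /=.
  rewrite !big_bool /= !mulr1 !mul1r !mulrN1 scale1r !scaleN1r scaleNr.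
  by rewrite {1}VE E1 E2 scalerBr.
- by case=> -[] -[] /=; rewrite rnormM ?rnormN ?rnorm_i ?(@rnorm_nat R 1) ?mulr1.
- case=> -[] -[] /=; [exact: le_trans p1 n1|exact: le_trans m1 n1|
    exact: le_trans p2 n2|exact: le_trans m2 n2].
Qed.

Section Forms.
Context (T : Type) (D : T -> T -> C) (n : nat) (x : 'M[T]_n).
Implicit Types V W : 'M[C]_n.

Lemma oformDl V V' W : oform D x (V + V') W = oform D x V W + oform D x V' W.
Proof.
rewrite /oform; do 4![rewrite -big_split /=; apply: eq_bigr => ? _].
by rewrite !mxE mulrDr mulrDl.
Qed.

Lemma oformDr V W W' : oform D x V (W + W') = oform D x V W + oform D x V W'.
Proof.
rewrite /oform; do 4![rewrite -big_split /=; apply: eq_bigr => ? _].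
by rewrite !mxE rmorphD mulrDr.
Qed.

Lemma oformZl a V W : oform D x (a *: V) W = a * oform D x V W.
Proof.
rewrite /oform; do 4![rewrite mulr_sumr; apply: eq_bigr => ? _].
by rewrite !mxE; ring.
Qed.

Lemma oformZr a V W : oform D x V (a *: W) = a^* * oform D x V W.
Proof.
rewrite /oform; do 4![rewrite mulr_sumr; apply: eq_bigr => ? _].
by rewrite !mxE rmorphM /=; ring.
Qed.

Lemma oform0l W : oform D x 0 W = 0.
Proof. by rewrite -(scale0r 0) oformZl mul0r. Qed.

Lemma oform0r V : oform D x V 0 = 0.
Proof. by rewrite -(scale0r 0) oformZr rmorph0 mul0r. Qed.

Lemma oform_sum (I : finType) (a b : I -> C) (V W : I -> 'M[C]_n) :
  oform D x (\sum_i a i *: V i) (\sum_j b j *: W j) =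
  \sum_i \sum_j a i * (b j)^* * oform D x (V i) (W j).
Proof.
rewrite (big_morph (fun V => oform D x V _) (fun V V' => oformDl V V' _) (oform0l _)).
apply: eq_bigr => i _; rewrite oformZl.
rewrite (big_morph (oform D x _) (oformDr _) (oform0r _)) mulr_sumr.
by apply: eq_bigr => j _; rewrite oformZr mulrA.
Qed.

End Forms.

Section FormsOfInnerProducts.
Context (V : lmodType C) (D : V -> V -> C) (ipD : inner_product D).

(** The entry in row [t] and column [s] of the matrix [B^* x A] over [V]. *)
Definition pairing n p q (x : 'M[V]_n) (A : 'M[C]_(n, p)) (B : 'M[C]_(n, q)) s t : V :=
  \sum_k \sum_l (A l s * (B k t)^*) *: x k l.

Lemma oform_outer n p q (x : 'M[V]_n) (A : 'M[C]_(n, p)) (B : 'M[C]_(n, q)) :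
  oform D x (outer A) (outer B) =
  toC (\sum_s \sum_t sqnorm D (pairing x A B s t)).
Proof.
rewrite rmorph_sum; transitivity (\sum_s \sum_t \sum_k \sum_k' \sum_l \sum_l'
   D (x k l) (x k' l') * (A l s * (A l' s)^*) * (B k t * (B k' t)^*)^*).
  rewrite /oform; transitivity (\sum_k \sum_k' \sum_l \sum_l' \sum_s \sum_t
     D (x k l) (x k' l') * (A l s * (A l' s)^*) * (B k t * (B k' t)^*)^*).
    do 4![apply: eq_bigr => ? _]; rewrite !mxE rmorph_sum mulr_sumr mulr_suml.
    by apply: eq_bigr => s _; rewrite mulr_sumr.
  have ex6 (F : 'I_n -> 'I_n -> 'I_n -> 'I_n -> 'I_p -> 'I_q -> C) :
     \sum_k \sum_k' \sum_l \sum_l' \sum_s \sum_t F k k' l l' s t =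
     \sum_s \sum_t \sum_k \sum_k' \sum_l \sum_l' F k k' l l' s t.
    do 3![rewrite [LHS]pair_bigA /=].
    rewrite exchange_big; apply: eq_bigr => s _.
    rewrite exchange_big; apply: eq_bigr => t _.
    by do 3![rewrite [RHS]pair_bigA /=].
  by rewrite ex6.
apply: eq_bigr => s _; rewrite rmorph_sum; apply: eq_bigr => t _ /=.
rewrite -(sqnormE ipD) /pairing (ip_suml ipD); apply: eq_bigr => k _.
rewrite (ip_sumr ipD); apply: eq_bigr => k' _.
rewrite (ip_suml ipD); apply: eq_bigr => l _.
rewrite (ip_sumr ipD); apply: eq_bigr => l' _.
rewrite (ipZl ipD) (ipZr ipD) !rmorphM /= !conjCK; ring.
Qed.

End FormsOfInnerProducts.

End OhForms.

Section OhBounds.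
Context {R : realType}.
Local Notation C := R[i].
Local Notation toC := (real_complex R).

Section Bounds.
Context (V : lmodType C) (D : V -> V -> C) (ipD : inner_product D).

Lemma oform_outer_ge0 n p q (x : 'M[V]_n) (A : 'M[C]_(n, p)) (B : 'M[C]_(n, q)) :
  0 <= oform D x (outer A) (outer B).
Proof.
rewrite (oform_outer ipD) ler0c sumr_ge0 // => s _; rewrite sumr_ge0 // => t _.
exact: sqnorm_ge0.
Qed.

(* 16 = 4 * 4: both matrices are split into four positive semidefinite ones. *)
Lemma ohle_oform n (x : 'M[V]_n) c (U W : 'M[C]_n) : 0 <= c -> ohle D x c ->
  rnorm (oform D x U W) <= 16 * c * (hsnorm U * hsnorm W).
Proof.
move=> c0 xc; have [a [P [-> a1 PU]]] := psd_decomposition U.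
have [b [Q [-> b1 QW]]] := psd_decomposition W.
set U' := \sum_i _; set W' := \sum_i _.
rewrite /U' /W' oform_sum; apply: le_trans (rnorm_sum _ _ _) _.
have E16 : 16 * c * (hsnorm U' * hsnorm W')
    = \sum_(i : bool * bool) \sum_(j : bool * bool) c * (hsnorm U' * hsnorm W').
  rewrite !sumr_const !card_prod !card_bool -mulrnA -mulr_natl; ring.
rewrite E16; apply: ler_sum => i _; apply: le_trans (rnorm_sum _ _ _) _.
apply: ler_sum => j _; rewrite !rnormM rnorm_conj a1 b1 !mul1r.
rewrite rnorm_ge0E ?oform_outer_ge0 //; apply: le_trans (xc _ _ _ _) _.
by rewrite ler_wpM2l // ler_pM ?hsnorm_ge0 // /U' /W' ?PU ?QW.
Qed.

Lemma ohle_cmxnorm n (x : 'M[V]_n) c : 0 <= c -> ohle D x c ->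
  cmxnorm (gram D x) <= 16 * c.
Proof.
move=> c0 xc; apply: cmxnorm_mxform; first by rewrite mulr_ge0.
move=> v w; rewrite -[v]flatK -[w]flatK mxform_gram -!hsnorm_flat.
exact: ohle_oform.
Qed.

Lemma ohleD n (x y : 'M[V]_n) c d :
  ohle D x c -> ohle D y d -> ohle D (x + y) (2 * c + 2 * d).
Proof.
move=> xc yd p q A B; rewrite mulrDl -!mulrA.
apply: (@le_trans _ _ (2 * complex.Re (oform D x (outer A) (outer B))
   + 2 * complex.Re (oform D y (outer A) (outer B)))); last first.
  by rewrite lerD // ler_pM2l // ?xc ?yd.
rewrite !(oform_outer ipD) /= !mulr_sumr -big_split /=; apply: ler_sum => s _.
rewrite !mulr_sumr -big_split /=; apply: ler_sum => t _.
apply: le_trans (sqnormD_le ipD _ _); rewrite le_eqVlt; apply/orP; left.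
apply/eqP; congr sqnorm; rewrite /pairing -big_split; apply: eq_bigr => k _.
by rewrite -big_split; apply: eq_bigr => l _; rewrite mxE scalerDr.
Qed.

Lemma ohleZ n (x : 'M[V]_n) a c :
  ohle D x c -> ohle D (map_mx ( *:%R a) x) (rnorm a ^+ 2 * c).
Proof.
move=> xc p q A B; rewrite -mulrA.
apply: le_trans (ler_wpM2l (sqr_ge0 _) (xc _ _ A B)).
rewrite !(oform_outer ipD) /= !mulr_sumr; apply: ler_sum => s _.
rewrite !mulr_sumr; apply: ler_sum => t _; rewrite -(sqnormZ ipD).
rewrite le_eqVlt; apply/orP; left; apply/eqP; congr sqnorm.
rewrite /pairing scaler_sumr; apply: eq_bigr => k _.
rewrite scaler_sumr; apply: eq_bigr => l _.
by rewrite mxE !scalerA mulrC.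
Qed.

End Bounds.

Lemma cmxnorm_oform (T : Type) (D : T -> T -> C) n (x : 'M[T]_n) (U W : 'M[C]_n) :
  rnorm (oform D x U W) <= cmxnorm (gram D x) * (hsnorm U * hsnorm W).
Proof. by rewrite -mxform_gram !hsnorm_flat mxform_le. Qed.

Lemma cmxnorm_ohle (T : Type) (D : T -> T -> C) n (x : 'M[T]_n) :
  ohle D x (cmxnorm (gram D x)).
Proof.
by move=> p q A B; apply: le_trans (Re_le_rnorm _) _; exact: cmxnorm_oform.
Qed.

Lemma ohle_le (T : Type) (D : T -> T -> C) n (x : 'M[T]_n) c d :
  c <= d -> ohle D x c -> ohle D x d.
Proof.
move=> cd xc p q A B; apply: le_trans (xc _ _ _ _) _.
by rewrite ler_wpM2r ?mulr_ge0 ?hsnorm_ge0.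
Qed.

(** The map with index n is controlled on n by n matrices only; padding by zeros carries this
    control to all smaller sizes. *)
Definition pad (V : zmodType) k r (x : 'M[V]_k) : 'M[V]_(k + r) :=
  block_mx x 0 0 0.

Section Padding.
Context (V : zmodType) (k r : nat) (x : 'M[V]_k).

Lemma pad_ll i j : pad r x (lshift r i) (lshift r j) = x i j.
Proof. exact: block_mxEul. Qed.

Lemma pad_r i j : pad r x (rshift k i) j = 0.
Proof. by rewrite /pad block_mxEv col_mxEd row_mx0 mxE. Qed.

Lemma pad_c i j : pad r x i (rshift k j) = 0.
Proof. by rewrite /pad block_mxEh row_mxEr col_mx0 mxE. Qed.

End Padding.

Lemma outer_usubmx k r p (A : 'M[C]_(k + r, p)) :
  outer (usubmx A) = ulsubmx (outer A).
Proof. by apply/matrixP => i j; rewrite !mxE; apply: eq_bigr => s _; rewrite !mxE. Qed.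

Lemma hsnorm_ulsubmx k r (W : 'M[C]_(k + r)) : hsnorm (ulsubmx W) <= hsnorm W.
Proof.
have sq0 i j : 0 <= rnorm (W i j) ^+ 2 by exact: sqr_ge0.
apply: ler_wsqrtr; rewrite big_split_ord /=.
apply: ler_wpDr; first by do 2![apply: sumr_ge0 => ? _].
apply: ler_sum => i _; rewrite big_split_ord /=.
apply: ler_wpDr; first by apply: sumr_ge0.
by apply: ler_sum => j _; rewrite !mxE.
Qed.

Lemma hsnorm_pad k r (W : 'M[C]_k) : hsnorm (pad r W) = hsnorm W.
Proof.
rewrite /hsnorm big_split_ord /= [X in _ + X]big1 ?addr0; last first.
  by move=> i _; rewrite big1 // => j _; rewrite pad_r rnorm0 expr0n.
congr Num.sqrt; apply: eq_bigr => i _; rewrite big_split_ord /= [X in _ + X]big1 ?addr0.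
  by apply: eq_bigr => j _; rewrite pad_ll.
by move=> j _; rewrite pad_c rnorm0 expr0n.
Qed.

Lemma outer_col_mx0 k r p (A : 'M[C]_(k, p)) :
  outer (col_mx A 0) = pad r (outer A).
Proof.
apply/matrixP => i j; rewrite mxE.
have z l s : col_mx A (0 : 'M_(r, p)) (rshift k l) s = 0 by rewrite col_mxEd mxE.
case: (split_ordP i) => i' ->; last first.
  by rewrite pad_r big1 // => s _; rewrite z mul0r.
case: (split_ordP j) => j' ->; last first.
  by rewrite pad_c big1 // => s _; rewrite z rmorph0 mulr0.
by rewrite pad_ll mxE; apply: eq_bigr => s _; rewrite !col_mxEu.
Qed.

Section PaddedForms.
Context (V : lmodType C) (D : V -> V -> C) (ipD : inner_product D).

Lemma oform_pad k r (x : 'M[V]_k) (U W : 'M[C]_(k + r)) :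
  oform D (pad r x) U W = oform D x (ulsubmx U) (ulsubmx W).
Proof.
rewrite /oform big_split_ord /= [X in _ + X]big1 ?addr0; last first.
  by move=> i _; do 3![rewrite big1 // => ? _]; rewrite pad_r (ip0l ipD) !mul0r.
apply: eq_bigr => i _; rewrite big_split_ord /= [X in _ + X]big1 ?addr0; last first.
  by move=> i' _; do 2![rewrite big1 // => ? _]; rewrite pad_r (ip0r ipD) !mul0r.
apply: eq_bigr => i' _; rewrite big_split_ord /= [X in _ + X]big1 ?addr0; last first.
  by move=> j _; do 1![rewrite big1 // => ? _]; rewrite pad_c (ip0l ipD) !mul0r.
apply: eq_bigr => j _; rewrite big_split_ord /= [X in _ + X]big1 ?addr0; last first.
  by move=> j' _; rewrite pad_c (ip0r ipD) !mul0r.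
by apply: eq_bigr => j' _; rewrite !pad_ll !mxE.
Qed.

(** In one direction the test matrices get zero rows. In the other they are compressed to the upper
    left corner, which is again of the form [outer] and has no larger norm. *)
Lemma ohle_pad k r (x : 'M[V]_k) c : 0 <= c ->
  ohle D (pad r x) c <-> ohle D x c.
Proof.
move=> c0; split=> h p q A B.
  have := h _ _ (col_mx A (0 : 'M_(r, p))) (col_mx B (0 : 'M_(r, q))).
  by rewrite !outer_col_mx0 !hsnorm_pad oform_pad /pad !block_mxKul.
rewrite oform_pad -!outer_usubmx; apply: le_trans (h _ _ _ _) _.
by rewrite ler_wpM2l // ler_pM ?hsnorm_ge0 // outer_usubmx hsnorm_ulsubmx.
Qed.

End PaddedForms.

End OhBounds.

Lemma big_fset_split (V : nmodType) (I : choiceType) (F G : {fset I}) (f : I -> V) :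
  (F `<=` G)%fset ->
  \sum_(i <- G) f i = \sum_(i <- F) f i + \sum_(i <- (G `\` F)%fset) f i.
Proof.
move=> FG; rewrite (@big_fsetID _ _ _ _ (mem F) G) /=; congr (_ + _); apply: eq_fbigl => i.
  rewrite !inE /=; apply/andP/idP => [[]//|iF]; split => //.
  exact: (fsubsetP FG).
by rewrite !inE andbC.
Qed.

(** * The inner product of l_2(I) and the norm of OH(I) *)

Section L2Inner.
Context {R : realType} (I : choiceType).
Local Notation C := R[i].
Local Notation toC := (real_complex R).
Local Notation l2I := (@l2 R I).

Lemma l2_valD (x y : l2I) i : l2_val (x + y) i = l2_val x i + l2_val y i.
Proof. by []. Qed.

Lemma l2_valZ a (x : l2I) i : l2_val (a *: x) i = a * l2_val x i.
Proof. by []. Qed.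

Lemma l2_valN (x : l2I) i : l2_val (- x) i = - l2_val x i.
Proof. by []. Qed.

Lemma l2_ext (x y : l2I) : (forall i, l2_val x i = l2_val y i) -> x = y.
Proof. by move=> xy; apply: val_inj; apply/funext. Qed.

Lemma l2_bounded (x : l2I) :
  exists M : R, forall F : {fset I}, \sum_(i <- F) rnorm (l2_val x i) ^+ 2 <= M.
Proof.
have /asboolP := l2_valP x; set e := esum _ _ => e_fin.
have e0 : (0 <= e)%E by apply: esum_ge0 => i _; rewrite lee_fin sqr_ge0.
exists (fine e) => F; rewrite -lee_fin fineK ?ge0_fin_numE //.
apply: esum_ge; exists [set` F].
  by split => //; exact: finite_fset.
rewrite fsbig_finite ?finite_fset //= set_fsetK -sumEFin.
by [].
Qed.

Lemma l2_of_bounded (f : I -> C) (M : R) :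
  (forall F : {fset I}, \sum_(i <- F) rnorm (f i) ^+ 2 <= M) ->
  exists x : l2I, l2_val x = f.
Proof.
move=> fM; suff fP : f \in @l2_pred R I by exists (L2 fP).
apply/asboolP; apply: (@le_lt_trans _ _ M%:E); last exact: ltry.
apply: ge_ereal_sup => _ [A [finA _] <-].
by rewrite fsbig_finite //= sumEFin lee_fin.
Qed.

Lemma l2_sum_cvg (x : l2I) :
  exists s : R, fcvg (@totally I)
    (fun F => toC (\sum_(i <- F) rnorm (l2_val x i) ^+ 2)) (toC s).
Proof.
have [M xM] := l2_bounded x.
pose S := [set \sum_(i <- F) rnorm (l2_val x i) ^+ 2 | F in [set: {fset I}]].
have Sub : has_ubound S by exists M => _ [F _ <-].
have S0 : S !=set0 by exists (\sum_(i <- fset0) rnorm (l2_val x i) ^+ 2); exists fset0.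
exists (sup S) => e e0.
have [_ [F _ <-] Fe] := sup_adherent e0 (conj S0 Sub).
exists F => // G /= FG; rewrite -rmorphB rnorm_real.
have GS : \sum_(i <- G) rnorm (l2_val x i) ^+ 2 <= sup S.
  by apply: ub_le_sup => //; exists G.
rewrite ler0_norm ?subr_le0 // opprB ltrBlDr -ltrBlDl; apply: lt_le_trans Fe _.
by rewrite (big_fset_split _ FG) lerDl sumr_ge0 // => i _; exact: sqr_ge0.
Qed.

(* By polarization, sums of products reduce to sums of squares, which are
   monotone. *)
Lemma l2_ip_cvg (x y : l2I) : exists l : C, fcvg (@totally I)
  (fun F => \sum_(i <- F) l2_val x i * (l2_val y i)^*) l.
Proof.
have h (c : C) : exists s : R, fcvg (@totally I)
    (fun F => toC (\sum_(i <- F) rnorm (l2_val x i + c * l2_val y i) ^+ 2)) (toC s).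
  exact: (l2_sum_cvg (x + c *: y)).
have FF := @totally_filter I.
have [[s1 h1] [s2 h2]] := (h 1, h (-1)).
have [[s3 h3] [s4 h4]] := (h 'i, h (- 'i)).
exists (4^-1 * (toC s1 + (-1) * toC s2 + ('i * toC s3 + (- 'i) * toC s4))).
apply: fcvg_eq.
  apply: fcvgZ; apply: fcvgD; apply: fcvgD; last 2 first.
  - by apply: fcvgZ; exact: h3.
  - by apply: fcvgZ; exact: h4.
  - exact: h1.
  - by apply: fcvgZ; exact: h2.
move=> F /=; rewrite !rmorph_sum !mulr_sumr -!big_split mulr_sumr /=.
apply: eq_bigr => i _; rewrite -!mulC_conj.
set a := l2_val x i; set b := l2_val y i.
rewrite !rmorphD /= !rmorphM /= !rmorphN /= rmorph1 conjCi.
have i2 : 'i * 'i = -1 :> C by rewrite -expr2 sqrCi.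
(* The products ['i * 'i] stay explicit, because the relation ['i * 'i = -1] is not a ring
   identity. *)
transitivity (4^-1 * (2 * (a * b^* + b * a^*) - 2 * ('i * 'i) * (a * b^* - b * a^*)) : C).
  by rewrite i2; field.
by ring.
Qed.

Definition l2_ip (x y : l2I) : C := projT1 (cid (l2_ip_cvg x y)).

Lemma l2_ipP (x y : l2I) : fcvg (@totally I)
  (fun F => \sum_(i <- F) l2_val x i * (l2_val y i)^*) (l2_ip x y).
Proof. exact: projT2 (cid (l2_ip_cvg x y)). Qed.

Local Existing Instance totally_filter.

Lemma l2_ipE (x y : l2I) l : fcvg (@totally I)
  (fun F => \sum_(i <- F) l2_val x i * (l2_val y i)^*) l -> l2_ip x y = l.
Proof. by move=> h; apply: (fcvg_uniq (l2_ipP x y) h). Qed.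

Lemma l2_inner_product : inner_product l2_ip.
Proof.
split.
- move=> a x y z; apply: l2_ipE.
  apply: fcvg_eq (fcvgD (fcvgZ a (l2_ipP x z)) (l2_ipP y z)) _ => F.
  rewrite mulr_sumr -big_split; apply: eq_bigr => i _.
  by rewrite l2_valD l2_valZ mulrDl mulrA.
- move=> x y; apply: l2_ipE; apply: fcvg_eq (fcvg_conj (l2_ipP x y)) _ => F /=.
  by rewrite rmorph_sum; apply: eq_bigr => i _; rewrite rmorphM /= conjCK mulrC.
- move=> x; apply: (fcvg_ge0 (l2_ipP x x)); apply: filterE => F /=.
  by apply: sumr_ge0 => i _; rewrite mulC_conj ler0c sqr_ge0.
Qed.

Lemma oh_partialE n (x : 'M[l2I]_n) (F : {fset I}) :
  oh_partial x F = Num.sqrt (cmxnorm (\matrix_(p, q)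
    \sum_(i <- F) l2_val (x (mxtens_unindex p).1 (mxtens_unindex q).1) i *
       (l2_val (x (mxtens_unindex p).2 (mxtens_unindex q).2) i)^*)).
Proof.
congr (Num.sqrt (cmxnorm _)); apply/matrixP => p q; rewrite summxE mxE.
by apply: eq_bigr => i _; rewrite !mxE.
Qed.

(** The entries of the partial sums in Pisier's formula converge to inner products, and the norm of
    matrices of a fixed size is continuous in the entries. *)
Lemma oh_normE n (x : 'M[l2I]_n) : oh_norm x = Num.sqrt (cmxnorm (gram l2_ip x)).
Proof.
apply: cvg_lim; first exact: Rhausdorff.
pose E (F : {fset I}) : 'M[C]_(n * n) := \matrix_(p, q)
    \sum_(i <- F) l2_val (x (mxtens_unindex p).1 (mxtens_unindex q).1) i *
       (l2_val (x (mxtens_unindex p).2 (mxtens_unindex q).2) i)^*.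
have -> : oh_partial x = fun F => Num.sqrt (cmxnorm (E F)).
  by apply/funext => F; exact: oh_partialE.
apply: (@continuous_cvg _ _ _ _ _ _ (@Num.sqrt R)); first exact: sqrt_continuous.
apply/cvgrPdist_lt => e e0.
(* There are [n ^ 4] entries; the successor keeps [N] positive for [n = 0] and makes the final
   inequality strict. *)
pose N : R := (n * n * (n * n)).+1%:R.
have N0 : 0 < N by rewrite ltr0n.
have eN : 0 < e / N by rewrite divr_gt0.
have tF : Filter (@totally I) by apply: filter_filter.
have all_close : (@totally I) [set F | forall pq : 'I_(n * n) * 'I_(n * n),
    rnorm (E F pq.1 pq.2 - gram l2_ip x pq.1 pq.2) < e / N].
  apply: (@filter_forall _ _ (fun (pq : 'I_(n * n) * 'I_(n * n)) F =>
    rnorm (E F pq.1 pq.2 - gram l2_ip x pq.1 pq.2) < e / N) _ tF) => -[p q].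
  apply: (filterS _ (l2_ipP _ _ eN)) => F h; rewrite !mxE; exact: h.
apply: (filterS _ all_close) => F h; rewrite distrC; apply: le_lt_trans (cmxnorm_dist _ _) _.
apply: (@le_lt_trans _ _ (\sum_(p < n * n) \sum_(q < n * n) e / N)).
  by apply: ler_sum => p _; apply: ler_sum => q _; exact: ltW (h (p, q)).
rewrite !sumr_const !card_ord -mulrnA -mulr_natr mulrAC ltr_pdivrMr //.
by rewrite ltr_pM2l // ltr_nat.
Qed.

Lemma oh_norm_ge0 n (x : 'M[l2I]_n) : 0 <= oh_norm x.
Proof. by rewrite oh_normE sqrtr_ge0. Qed.

Lemma oh_norm_sqr n (x : 'M[l2I]_n) : oh_norm x ^+ 2 = cmxnorm (gram l2_ip x).
Proof. by rewrite oh_normE sqr_sqrtr ?cmxnorm_ge0. Qed.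

Lemma oh_norm_ohle n (x : 'M[l2I]_n) : ohle l2_ip x (oh_norm x ^+ 2).
Proof. by rewrite oh_norm_sqr; exact: cmxnorm_ohle. Qed.

Lemma ohle_oh_norm n (x : 'M[l2I]_n) c : 0 <= c ->
  ohle l2_ip x c -> oh_norm x ^+ 2 <= 16 * c.
Proof. by rewrite oh_norm_sqr; exact: (ohle_cmxnorm l2_inner_product). Qed.

End L2Inner.

(** * Matrix norms of an operator space *)

Section OperatorSpaceNorm.
Context {R : realType} (X : opspace R).
Local Notation C := R[i].
Local Notation toC := (real_complex R).
Local Notation H := (os_hilbert X).

Lemma hdot_inner_product : inner_product (hdot H).
Proof.
split.
- by move=> a x y z; rewrite linearDl linearZl_LR.
- by move=> x y; rewrite hermC /= expr0 mul1r.
- by move=> x; rewrite hdotE exprn_ge0.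
Qed.

Lemma os_valD (a b : X) xi : os_val (a + b) xi = os_val a xi + os_val b xi.
Proof. by []. Qed.

Lemma os_valN (a : X) xi : os_val (- a) xi = - os_val a xi.
Proof. by []. Qed.

Lemma os_valZ (l : C) (a : X) xi : os_val (l *: a) xi = l *: os_val a xi.
Proof. by []. Qed.

Lemma os_val_bounded (a : X) : bounded_operators H (os_val a).
Proof. by apply: (@os_bounded R X); apply/asboolP; exact: os_valP. Qed.

Lemma os_val_lin (a : X) l xi eta :
  os_val a (l *: xi + eta) = l *: os_val a xi + os_val a eta.
Proof. by have [h _] := os_val_bounded a; rewrite h. Qed.

Lemma os_val0 (a : X) : os_val a 0 = 0.
Proof.
have := os_val_lin a 1 0 0; rewrite !scale1r addr0.
by move/(congr1 (fun z => z - os_val a 0)); rewrite addrK subrr => /esym.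
Qed.

Lemma os_val_scale (a : X) l xi : os_val a (l *: xi) = l *: os_val a xi.
Proof. by have := os_val_lin a l xi 0; rewrite os_val0 !addr0. Qed.

Lemma os_ext (a b : X) : (forall xi, os_val a xi = os_val b xi) -> a = b.
Proof. by move=> ab; apply: val_inj; apply/funext. Qed.

Local Notation act A := (mxact (map_mx (@os_val R X) A)).

Lemma mxactE n (A : 'M[X]_n) xi i : act A xi i 0 = \sum_j os_val (A i j) (xi j 0).
Proof. by rewrite mxE; apply: eq_bigr => j _; rewrite mxE. Qed.

Lemma mxact_bounded n (A : 'M[X]_n) :
  exists M : R, forall xi, l2norm (act A xi) <= M * l2norm xi.
Proof.
have hb (ij : 'I_n * 'I_n) : exists M : R,
    forall xi, rnorm (os_val (A ij.1 ij.2) xi) <= M * rnorm xi.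
  by have [_] := os_val_bounded (A ij.1 ij.2).
have /choice [M hM] := hb.
exists (\sum_i \sum_j `|M (i, j)|) => xi; apply: le_trans (l2norm_le_sum _) _.
rewrite mulr_suml; apply: ler_sum => i _; rewrite mxactE.
apply: le_trans (rnorm_sum _ _ _) _; rewrite mulr_suml; apply: ler_sum => j _.
apply: le_trans (hM (i, j) _) _ => /=.
apply: (@le_trans _ _ (`|M (i, j)| * rnorm (xi j 0))).
  by rewrite ler_wpM2r ?rnorm_ge0 ?ler_norm.
by rewrite ler_wpM2l // rnorm_le_l2norm.
Qed.

Local Notation homH n := (l2norm_homogeneous hdot_inner_product (hdotE (h := H)) n).

Lemma mxact_scale n (A : 'M[X]_n) l (xi : 'cV[H]_n) :
  act A (\col_i (l *: xi i 0)) = \col_i (l *: act A xi i 0).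
Proof.
apply/colP => i; rewrite mxactE [RHS]mxE mxactE scaler_sumr.
by apply: eq_bigr => j _; rewrite mxE os_val_scale.
Qed.

Lemma mxnormP n (A : 'M[X]_n) xi : l2norm (act A xi) <= mxnorm A * l2norm xi.
Proof.
have [M hM] := mxact_bounded A.
exact: (opnormP 0 (homH n) (homH n) (mxact_scale A) hM).
Qed.

Lemma mxnorm_ge0 n (A : 'M[X]_n) : 0 <= mxnorm A.
Proof.
have [M hM] := mxact_bounded A; exact: (opnorm_ge0 0 (homH n) (homH n) hM).
Qed.

Lemma mxnorm_le n (A : 'M[X]_n) c : 0 <= c ->
  (forall xi, l2norm (act A xi) <= c * l2norm xi) -> mxnorm A <= c.
Proof. exact: (opnorm_le 0 (homH n)). Qed.

Lemma mxnormZ_le n l (A : 'M[X]_n) :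
  mxnorm (map_mx ( *:%R l) A) <= rnorm l * mxnorm A.
Proof.
apply: mxnorm_le; first by rewrite mulr_ge0 ?rnorm_ge0 ?mxnorm_ge0.
move=> xi; rewrite -mulrA; apply: le_trans (ler_wpM2l (rnorm_ge0 l) (mxnormP A xi)).
rewrite -(l2normZ hdot_inner_product (hdotE (h := H))) le_eqVlt; apply/orP; left.
apply/eqP; congr l2norm; apply/colP => i; rewrite mxactE [RHS]mxE mxactE scaler_sumr.
by apply: eq_bigr => j _; rewrite mxE os_valZ.
Qed.

Lemma mxnormZ n l (A : 'M[X]_n) :
  mxnorm (map_mx ( *:%R l) A) = rnorm l * mxnorm A.
Proof.
apply/le_anti/andP; split; first exact: mxnormZ_le.
have [->|l0] := eqVneq l 0; first by rewrite rnorm0 mul0r mxnorm_ge0.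
have rl0 : 0 < rnorm l by rewrite lt_def rnorm_eq0 l0 rnorm_ge0.
rewrite -ler_pdivlMl //.
have <- : rnorm l^-1 = (rnorm l)^-1.
  apply: (@mulfI _ (rnorm l)); rewrite ?rnorm_eq0 //.
  by rewrite -rnormM !mulfV ?rnorm_eq0 // (@rnorm_nat _ 1).
apply: le_trans (mxnormZ_le _ _); rewrite le_eqVlt; apply/orP; left; apply/eqP.
by congr mxnorm; apply/matrixP => i j; rewrite !mxE scalerA mulVf // scale1r.
Qed.

Lemma mxnorm_eq0 n (A : 'M[X]_n) : mxnorm A = 0 -> A = 0.
Proof.
move=> A0; apply/matrixP => i j; rewrite mxE; apply: os_ext => xi.
apply/eqP; rewrite -rnorm_eq0 eq_le rnorm_ge0 andbT.
pose x : 'cV[H]_n := \col_l (if l == j then xi else 0).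
have <- : act A x i 0 = os_val (A i j) xi.
  rewrite mxactE (bigD1 j) //= big1 ?addr0 ?mxE ?eqxx // => l lj.
  by rewrite mxE (negbTE lj) os_val0.
apply: le_trans (rnorm_le_l2norm _ _) _; apply: le_trans (mxnormP _ _) _.
by rewrite A0 mul0r.
Qed.

Lemma l2norm_col_mx k r (x : 'cV[H]_k) (y : 'cV[H]_r) :
  l2norm x <= l2norm (col_mx x y).
Proof.
apply: ler_wsqrtr; rewrite big_split_ord /=; apply: ler_wpDr.
  by apply: sumr_ge0 => i _; exact: sqr_ge0.
by apply: ler_sum => i _; rewrite col_mxEu.
Qed.

Lemma l2norm_col_mx0 k r (x : 'cV[H]_k) : l2norm (col_mx x (0 : 'cV[H]_r)) = l2norm x.
Proof.
rewrite /l2norm big_split_ord /= [X in _ + X]big1 ?addr0; last first.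
  by move=> i _; rewrite col_mxEd mxE rnorm0 expr0n.
by congr Num.sqrt; apply: eq_bigr => i _; rewrite col_mxEu.
Qed.

Lemma mxact_pad k r (A : 'M[X]_k) (x : 'cV[H]_k) (y : 'cV[H]_r) :
  act (pad r A) (col_mx x y) = col_mx (act A x) 0.
Proof.
apply/colP => i; rewrite mxactE; case: (split_ordP i) => i' ->.
  rewrite col_mxEu mxactE big_split_ord /= [X in _ + X]big1 ?addr0.
    by apply: eq_bigr => j _; rewrite pad_ll col_mxEu.
  by move=> j _; rewrite pad_c.
by rewrite col_mxEd mxE big1 // => j _; rewrite pad_r.
Qed.

Lemma mxnorm_pad k r (A : 'M[X]_k) : mxnorm (pad r A) = mxnorm A.
Proof.
apply/le_anti/andP; split; apply: mxnorm_le; try exact: mxnorm_ge0.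
  move=> xi; rewrite -[xi]vsubmxK mxact_pad l2norm_col_mx0.
  apply: le_trans (mxnormP _ _) _; rewrite ler_wpM2l ?mxnorm_ge0 //.
  exact: l2norm_col_mx.
move=> xi; have := mxnormP (pad r A) (col_mx xi 0).
by rewrite mxact_pad !l2norm_col_mx0.
Qed.

Lemma l2norm_unitary n (U : 'M[C]_n) (x : 'cV[H]_n) :
  map_mx Num.conj U^T *m U = 1%:M ->
  l2norm (\col_i \sum_j U i j *: x j 0) = l2norm x.
Proof.
move=> UU; congr Num.sqrt; apply: complexI; rewrite !rmorph_sum.
have nE (z : H) : toC (rnorm z ^+ 2) = hdot H z z.
  by rewrite hdotE rnormE -rmorphXn.
have ip := hdot_inner_product.
transitivity (\sum_j \sum_j' (\sum_i (U i j')^* * U i j) * hdot H (x j 0) (x j' 0)).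
  rewrite (eq_bigr (fun i => \sum_j \sum_j' (U i j')^* * U i j * hdot H (x j 0) (x j' 0))).
    rewrite exchange_big; apply: eq_bigr => j _; rewrite exchange_big.
    by apply: eq_bigr => j' _; rewrite mulr_suml.
  move=> i _; apply: etrans (nE _) _; rewrite mxE (ip_suml ip).
  apply: eq_bigr => j _; rewrite (ip_sumr ip); apply: eq_bigr => j' _.
  by rewrite (ipZl ip) (ipZr ip) mulrA [U i j * _]mulrC.
have UE j' j : \sum_i (U i j')^* * U i j = (j' == j)%:R.
  have /matrixP /(_ j' j) := UU; rewrite !mxE => <-.
  by apply: eq_bigr => i _; rewrite !mxE.
apply: eq_bigr => j _; rewrite (bigD1 j) //= [X in _ + X]big1 => [|j' jj'].
  by rewrite UE eqxx mul1r addr0; apply: esym; exact: nE.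
by rewrite UE (negbTE jj') mul0r.
Qed.

Lemma mxact_const (a : X) (z : H) :
  act (const_mx a : 'M[X]_1) (const_mx z) = const_mx (os_val a z).
Proof. by apply/colP => i; rewrite mxactE big_ord1 !mxE. Qed.

Lemma l2norm_const (z : H) : l2norm (const_mx z : 'cV[H]_1) = rnorm z.
Proof. by rewrite /l2norm big_ord1 mxE sqrtr_sqr ger0_norm ?rnorm_ge0. Qed.

Lemma const_mx_col (xi : 'cV[H]_1) : xi = const_mx (xi 0 0).
Proof. by apply/colP => i; rewrite mxE !ord1. Qed.

Lemma rnorm_os_val (a : X) z : rnorm (os_val a z) <= mxnorm (const_mx a : 'M[X]_1) * rnorm z.
Proof.
by have := mxnormP (const_mx a : 'M[X]_1) (const_mx z); rewrite mxact_const !l2norm_const.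
Qed.

Lemma mxnorm_const_le (a : X) c : 0 <= c ->
  (forall z, rnorm (os_val a z) <= c * rnorm z) -> mxnorm (const_mx a : 'M[X]_1) <= c.
Proof.
move=> c0 h; apply: mxnorm_le => // xi.
by rewrite [xi]const_mx_col mxact_const !l2norm_const.
Qed.

(** The matrix is [U (x) a]: it applies [a] to every coordinate and then the isometry [U]. Columns
    with a single nonzero coordinate give the lower bound, and [0 < n] provides that coordinate. *)
Lemma mxnorm_unitary_scale n (U : 'M[C]_n) (a : X) : (0 < n)%N ->
  map_mx Num.conj U^T *m U = 1%:M ->
  mxnorm (\matrix_(i, j) (U i j *: a)) = mxnorm (const_mx a : 'M[X]_1).
Proof.
move=> n0 UU; pose x (xi : 'cV[H]_n) : 'cV[H]_n := \col_i os_val a (xi i 0).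
have actE (xi : 'cV[H]_n) : act (\matrix_(i, j) (U i j *: a)) xi = \col_i \sum_j U i j *: x xi j 0.
  apply/colP => i; rewrite mxactE mxE.
  by apply: eq_bigr => j _; rewrite !mxE.
apply/le_anti/andP; split; apply: mxnorm_le; try exact: mxnorm_ge0.
  move=> xi; rewrite actE l2norm_unitary //.
  rewrite -(@ler_pXn2r _ 2) ?nnegrE ?mulr_ge0 ?mxnorm_ge0 ?l2norm_ge0 //.
  rewrite exprMn !l2norm_sqr mulr_sumr; apply: ler_sum => i _.
  rewrite mxE -exprMn ler_pXn2r ?nnegrE ?mulr_ge0 ?mxnorm_ge0 ?rnorm_ge0 //.
  exact: rnorm_os_val.
move=> xi; rewrite [xi]const_mx_col; move: (xi 0 0) => {xi} z.
rewrite mxact_const !l2norm_const; pose i0 := Ordinal n0.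
pose eta : 'cV[H]_n := \col_i (if i == i0 then z else 0).
have single (w : H) : l2norm (\col_i (if i == i0 then w else 0) : 'cV[H]_n) = rnorm w.
  rewrite /l2norm (bigD1 i0) //= big1 ?addr0 => [|i ii0].
    by rewrite mxE eqxx sqrtr_sqr ger0_norm ?rnorm_ge0.
  by rewrite mxE (negbTE ii0) rnorm0 expr0n.
have := mxnormP (\matrix_(i, j) (U i j *: a)) eta.
rewrite actE l2norm_unitary // single.
rewrite (_ : x eta = \col_i (if i == i0 then os_val a z else 0)) ?single //.
by apply/colP => i; rewrite !mxE; case: ifP => // _; rewrite os_val0.
Qed.

End OperatorSpaceNorm.

(** * Asymptotic additivity *)

Section AlmostAffine.
Context {R : realType}.
Local Notation C := R[i].
Local Notation toC := (real_complex R).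

(** The entry sum is recorded because it becomes the weight of the first difference in
    [second_difference_bound]: it must be of smaller order than the number [n ^ 2] of entries. *)
Lemma sylvester_matrix m : exists (n : nat) (h : 'M[C]_n),
  [/\ n = (2 ^ m)%N, forall i j, h i j = 1 \/ h i j = -1,
      h^T *m h = n%:R%:M & \sum_i \sum_j h i j = n%:R].
Proof.
elim: m => [|m [n [h [nE h1 hh sh]]]].
  exists 1%N, 1%:M; split=> //.
  - by move=> i j; left; rewrite !ord1 mxE.
  - by rewrite trmx1 mulmx1.
  - by rewrite !big_ord1 mxE.
exists (n + n)%N, (block_mx h h h (- h)); split.
- by rewrite expnS nE mul2n addnn.
- move=> i j; case: (split_ordP i) => i' ->; case: (split_ordP j) => j' ->;
    rewrite ?block_mxEul ?block_mxEur ?block_mxEdl ?block_mxEdr ?mxE //.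
  by case: (h1 i' j') => ->; [right|left; rewrite opprK].
- have trN : (- h)^T = - h^T by apply/matrixP => i j; rewrite !mxE.
  rewrite tr_block_mx trN mulmx_block !mulmxN !mulNmx opprK subrr hh.
  have -> : (n%:R)%:M + (n%:R)%:M = (n + n)%:R%:M :> 'M[C]_n.
    by apply/matrixP => i j; rewrite !mxE natrD mulrnDl.
  by rewrite -scalar_mx_block.
- rewrite big_split_ord /= [X in _ + X]big1 ?addr0 => [|i _]; last first.
    rewrite big_split_ord /= -big_split big1 // => j _.
    by rewrite /= block_mxEdl block_mxEdr !mxE subrr.
  rewrite natrD -sh -big_split; apply: eq_bigr => i _; rewrite big_split_ord /=.
  by congr (_ + _); apply: eq_bigr => j _; rewrite ?block_mxEul ?block_mxEur.
Qed.

Context (I : choiceType) (X : opspace R).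
Local Notation l2I := (@l2 R I).
Local Notation nrm := (ipnorm (@l2_ip R I)).

(** Test with the all-ones matrix: it is [outer] of the all-ones column, its [hsnorm] is [n], and
    the form there is the square norm of the sum. *)
Lemma l2_sum_entries n (D : 'M[l2I]_n) :
  nrm (\sum_i \sum_j D i j) <= n%:R * oh_norm D.
Proof.
have ip := @l2_inner_product R I.
rewrite -(@ler_pXn2r _ 2) ?nnegrE ?mulr_ge0 ?oh_norm_ge0 ?ipnorm_ge0 //.
rewrite (ipnorm_sqr ip) exprMn.
have := oh_norm_ohle D (const_mx 1 : 'M_(n, 1)) (const_mx 1 : 'M_(n, 1)).
rewrite (oform_outer ip) /= !big_ord1.
have -> : hsnorm (outer (const_mx 1 : 'M[C]_(n, 1))) = n%:R.
  rewrite /hsnorm; under eq_bigr do under eq_bigr do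
    rewrite mxE big_ord1 !mxE mul1r rmorph1 (@rnorm_nat _ 1) expr1n.
  by rewrite !sumr_const card_ord -mulrnA natrM -expr2 sqrtr_sqr normr_nat.
have -> : pairing D (const_mx 1 : 'M_(n, 1)) (const_mx 1 : 'M_(n, 1)) ord0 ord0 =
    \sum_i \sum_j D i j.
  apply: eq_bigr => i _; apply: eq_bigr => j _.
  by rewrite !mxE mul1r rmorph1 scale1r.
by rewrite mulrC -expr2.
Qed.

Lemma second_difference_bound n N (h : 'M[C]_n) (f : X -> l2I) (om : R) (a b : X) :
  (0 < N)%N -> n = (N ^ 2)%N -> (forall i j, h i j = 1 \/ h i j = -1) ->
  h^T *m h = n%:R%:M -> \sum_i \sum_j h i j = n%:R ->
  (forall x y : 'M[X]_n, mxnorm (x - y) = mxnorm (const_mx b : 'M[X]_1) ->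
     oh_norm (map_mx f x - map_mx f y) <= om) ->
  N%:R * nrm (f (a + b) + f (a - b) - 2 *: f a) <=
    2 * om + nrm (f (a + b) - f (a - b)).
Proof.
move=> N0 nN h1 hh sh fom; have ip := @l2_inner_product R I.
have n0 : (0 < n)%N by rewrite nN expn_gt0 N0.
have NN : n%:R = N%:R ^+ 2 :> R by rewrite nN natrX.
have NR0 : 0 < N%:R :> R by rewrite ltr0n.
have NC0 : N%:R != 0 :> C by rewrite pnatr_eq0 -lt0n.
pose x t : 'M[X]_n := \matrix_(i, j) (a + (t%:R / N%:R * h i j) *: b).
have step t : oh_norm (map_mx f (x t.+1) - map_mx f (x t)) <= om.
  apply: fom; pose U : 'M[C]_n := \matrix_(i, j) (h i j / N%:R).
  rewrite -(@mxnorm_unitary_scale R X n U b n0).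
    congr mxnorm; apply/matrixP => i j; rewrite !mxE opprD addrACA subrr add0r.
    by rewrite -scalerBl -mulrBl -mulrBl -natrB // subSnn mul1r mulrC.
  have -> : map_mx Num.conj U^T = N%:R^-1 *: h^T.
    apply/matrixP => i j; rewrite !mxE rmorphM fmorphV rmorph_nat /= mulrC.
    by case: (h1 j i) => ->; rewrite ?rmorphN rmorph1.
  have -> : U = N%:R^-1 *: h by apply/matrixP => i j; rewrite !mxE mulrC.
  rewrite -scalemxAl -scalemxAr hh scalerA nN natrX.
  apply/matrixP => i j; rewrite !mxE; case: (i == j); rewrite ?mulr0n ?mulr0 // !mulr1n.
  by field.
(* [h / N] is unitary, so each of the N steps from [a] to [a + h_ij b] has the
   norm of [b] exactly; [om] is not assumed to control any other distance. *)
have total : nrm (\sum_i \sum_j (f (a + h i j *: b) - f a)) <= N%:R * (n%:R * om).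
  have -> : \sum_i \sum_j (f (a + h i j *: b) - f a) =
      \sum_(0 <= t < N) \sum_i \sum_j (map_mx f (x t.+1) - map_mx f (x t)) i j.
    rewrite [RHS]exchange_big; apply: eq_bigr => i _.
    rewrite [RHS]exchange_big; apply: eq_bigr => j _.
    under [RHS]eq_bigr do rewrite !mxE.
    rewrite (telescope_sumr (fun t => f (a + (t%:R / N%:R * h i j) *: b))) //.
    by rewrite mulfV // mul1r mul0r mul0r scale0r addr0.
  apply: le_trans (ipnorm_sum ip _ _ _) _.
  rewrite big_mkord mulr_natl -[X in _ *+ X]card_ord -sumr_const; apply: ler_sum => t _.
  by apply: le_trans (l2_sum_entries _) _; rewrite ler_wpM2l.
set P := f (a + b) + f (a - b) - 2 *: f a; set Q := f (a + b) - f (a - b).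
have sumE : \sum_i \sum_j (f (a + h i j *: b) - f a) =
    (n%:R ^+ 2 / 2) *: P + (n%:R / 2) *: Q.
  (* Even and odd part in the sign [h i j]. Only the odd part sees [h], so summation gives it the
     weight [n / 2] against [n ^ 2 / 2]. *)
  have termE i j : f (a + h i j *: b) - f a = 2^-1 *: P + (h i j / 2) *: Q.
    apply: l2_ext => k; rewrite /P /Q.
    case: (h1 i j) => ->; rewrite ?scaleN1r ?scale1r.
      by rewrite !(l2_valD, l2_valZ, l2_valN); field.
    by rewrite !(l2_valD, l2_valZ, l2_valN); field.
  under eq_bigr do under eq_bigr do rewrite termE.
  under eq_bigr do rewrite big_split /= sumr_const card_ord -scaler_suml -mulr_suml.
  rewrite big_split /= sumr_const card_ord -scaler_suml -mulr_suml sh.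
  by rewrite -mulrnA -scaler_nat scalerA natrM -expr2.
have lower : n%:R ^+ 2 / 2 * nrm P <= N%:R * (n%:R * om) + n%:R / 2 * nrm Q.
  have rc (t : C) (s : R) : 0 <= s -> t = toC s -> rnorm t = s.
    by move=> s0 ->; rewrite rnorm_real ger0_norm.
  have e1 : nrm ((n%:R ^+ 2 / 2) *: P) = n%:R ^+ 2 / 2 * nrm P.
    rewrite (ipnormZ ip) (rc _ (n%:R ^+ 2 / 2)) ?divr_ge0 ?sqr_ge0 //.
    by rewrite rmorphM fmorphV rmorphXn !rmorph_nat.
  have e2 : nrm ((n%:R / 2) *: Q) = n%:R / 2 * nrm Q.
    rewrite (ipnormZ ip) (rc _ (n%:R / 2)) ?divr_ge0 //.
    by rewrite rmorphM fmorphV !rmorph_nat.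
  rewrite -e1 -e2 -[X in nrm X](addrK ((n%:R / 2) *: Q)) -sumE.
  by apply: le_trans (ipnormB ip _ _) _; rewrite lerD2r.
have nR0 : 0 < n%:R :> R by rewrite ltr0n.
have := ipnorm_ge0 (@l2_ip R I) P; set p := nrm P; set q := nrm Q => p0.
have nN0 : 0 < n%:R / N%:R :> R by rewrite divr_gt0.
have : n%:R * p <= 2 * N%:R * om + q.
  rewrite -(ler_pM2l (_ : 0 < n%:R / 2)) ?divr_gt0 //.
  move: lower; rewrite -/p -/q expr2; lra.
have := ipnorm_ge0 (@l2_ip R I) Q; rewrite -/q => q0.
have N1 : 1 <= N%:R :> R by rewrite (ler_nat _ 1).
(* Since [n = N ^ 2], division by [N] gives the claim, with [q / N <= q]. *)
rewrite NN => h2; rewrite -(ler_pM2l NR0); nra.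
Qed.

End AlmostAffine.

Section RealLinearity.
Context {R : realType}.
Local Notation C := R[i].
Local Notation toC := (real_complex R).

(** Take the two points of the unit circle with real part [s]. *)
Lemma unit_average (s : R) : 0 <= s <= 1 ->
  exists u v : C, [/\ rnorm u = 1, rnorm v = 1 & toC s + toC s = u + v].
Proof.
move=> /andP[s0 s1]; set c := Num.sqrt (1 - s ^+ 2).
have s2 : s ^+ 2 + c ^+ 2 = 1.
  by rewrite sqr_sqrtr ?subr_ge0 ?expr_le1 //; ring.
exists (Complex s c), (Complex s (- c)); split.
- by rewrite /rnorm normc_def /= s2 sqrtr1.
- by rewrite /rnorm normc_def /= sqrrN s2 sqrtr1.
- by apply/eqP; rewrite eq_complex /= addr0 subrr !eqxx.
Qed.

(** Subtracting the linear candidate leaves an additive [psi] that vanishes on the integers, hence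
    is 1-periodic and bounded everywhere. Then [n * psi t = psi (n * t)] stays bounded as [n] grows,
    so [psi t = 0]. *)
Lemma additive_bounded_linear (phi : R -> C) (M : R) :
  (forall s t, phi (s + t) = phi s + phi t) ->
  (forall t, 0 <= t <= 1 -> rnorm (phi t) <= M) ->
  forall t, phi t = toC t * phi 1.
Proof.
move=> phiD phiM t.
pose psi s := phi s - toC s * phi 1.
have psiD s s' : psi (s + s') = psi s + psi s'.
  by rewrite /psi phiD rmorphD /=; ring.
have psi1 : psi 1 = 0 by rewrite /psi mul1r subrr.
have psi0 : psi 0 = 0 by apply: (addrI (psi 0)); rewrite -psiD !addr0.
have psiN s : psi (- s) = - psi s.
  by apply: (addrI (psi s)); rewrite -psiD !subrr.
have psin n s : psi (n%:R * s) = n%:R * psi s.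
  elim: n => [|n ih]; first by rewrite !mul0r.
  by rewrite -addn1 !natrD !mulrDl psiD ih !mul1r.
have psiz (z : int) : psi z%:~R = 0.
  have psinat n : psi n%:R = 0 by have := psin n 1; rewrite psi1 mulr0 mulr1.
  by case: z => n; rewrite ?NegzE ?mulrNz ?psiN ?psinat ?oppr0.
have psiM s : rnorm (psi s) <= M + M.
  have -> : psi s = psi (s - (Num.floor s)%:~R).
    by rewrite psiD psiN psiz subr0.
  set r := s - _; have r01 : 0 <= r <= 1.
    by have := floor_le s; have := floorD1_gt s; rewrite intrD /r; lra.
  apply: le_trans (rnormD _ _) _; rewrite rnormN rnormM rnorm_real.
  have M1 := phiM 1; rewrite ler01 lexx in M1; have {}M1 := M1 isT.
  have /andP[r0 r1] := r01.
  rewrite lerD ?phiM // ger0_norm //; have := rnorm_ge0 (phi 1); nra.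
apply/eqP; rewrite -subr_eq0 -/(psi t) -rnorm_eq0; apply/eqP/le_anti.
rewrite rnorm_ge0 andbT; apply/ler_addgt0Pl => e e0; rewrite addr0.
have M0 : 0 <= M + M by apply: le_trans (psiM 0); exact: rnorm_ge0.
pose n := (Num.truncn ((M + M) / e)).+1.
have n0 : 0 < n%:R :> R by rewrite ltr0n.
rewrite -(ler_pM2l n0) -[n%:R in leLHS](rnorm_nat (R := R)) -rnormM -psin.
apply: le_trans (psiM _) _; rewrite -ler_pdivrMr //; apply/ltW.
exact: truncnS_gt.
Qed.

End RealLinearity.

(** * The limit inner product *)

Section LinearDefect.
Context {R : realType} (I : choiceType) (X : opspace R).
Local Notation C := R[i].
Local Notation toC := (real_complex R).
Local Notation l2I := (@l2 R I).
Local Notation nrm := (ipnorm (@l2_ip R I)).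
Local Notation ip := (@l2_inner_product R I).
Local Notation "`[ a ]" := (mxnorm (const_mx a : 'M[X]_1)).

Context (omega rho : R -> R) (f : nat -> X -> l2I).
Context (omega0 : forall t, 0 <= t -> 0 <= omega t).
Context (rho0 : forall t, 0 <= t -> 0 <= rho t).
Context (rho_oo : rho t @[t --> +oo] --> +oo).
Context (coarse : forall (n : nat) (x y : 'M[X]_n), (0 < n)%N ->
  rho (mxnorm (x - y)) <= oh_norm (map_mx (f n) x - map_mx (f n) y)
    <= omega (mxnorm (x - y))).

Lemma ohle_const (V : lmodType C) (D : V -> V -> C) (a : V) c :
  inner_product D -> ohle D (const_mx a : 'M_1) c -> sqnorm D a <= c.
Proof.
move=> ipD h; have := h _ _ (1%:M : 'M_1) (1%:M : 'M_1).
have -> : outer (1%:M : 'M[C]_1) = 1%:M.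
  by apply/matrixP => i j; rewrite mxE big_ord1 !ord1 !mxE mul1r rmorph1.
rewrite /oform !big_ord1 !mxE conjC1 !mulr1 /hsnorm !big_ord1 mxE eqxx.
by rewrite (@rnorm_nat _ 1) expr1n sqrtr1 !mulr1.
Qed.

(** Zero has to go to zero for amplification to commute with padding ([pad_shifted]). *)
Definition shifted n (a : X) : l2I := f n a - f n 0.

Lemma pad_shifted k r (x : 'M[X]_k) :
  map_mx (f (k + r)) (pad r x) - map_mx (f (k + r)) 0 =
  pad r (map_mx (shifted (k + r)) x).
Proof.
have mapE m m' (F : X -> l2I) (A : 'M[X]_(m, m')) i j : map_mx F A i j = F (A i j).
  by rewrite mxE.
have subE m m' (A B : 'M[l2I]_(m, m')) i j : (A - B) i j = A i j - B i j.
  by rewrite !mxE.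
apply/matrixP => i j; rewrite subE !mapE [X in _ - f _ X]mxE.
case: (split_ordP i) => i' ->; last by rewrite !pad_r subrr.
case: (split_ordP j) => j' ->; last by rewrite !pad_c subrr.
by rewrite !pad_ll mapE.
Qed.

Lemma shifted_upper n k (x : 'M[X]_k) : (k <= n)%N -> (0 < n)%N ->
  ohle (@l2_ip R I) (map_mx (shifted n) x) (omega (mxnorm x) ^+ 2).
Proof.
move=> /subnKC <-; move: (n - k)%N => r n0.
have /andP[_] := coarse (pad r x) 0 n0.
rewrite subr0 pad_shifted mxnorm_pad => h.
apply/(ohle_pad ip r); first exact: sqr_ge0.
apply: ohle_le (oh_norm_ohle _).
by rewrite ler_pXn2r ?nnegrE ?oh_norm_ge0 ?omega0 ?mxnorm_ge0.
Qed.

Lemma shifted_lower n k (x : 'M[X]_k) c : (k <= n)%N -> (0 < n)%N -> 0 <= c ->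
  ohle (@l2_ip R I) (map_mx (shifted n) x) c -> rho (mxnorm x) ^+ 2 <= 16 * c.
Proof.
move=> /subnKC <-; move: (n - k)%N => r n0 c0 xc.
have /andP[h _] := coarse (pad r x) 0 n0; move: h.
rewrite subr0 pad_shifted mxnorm_pad => h.
apply: (@le_trans _ _ (oh_norm (pad r (map_mx (shifted (k + r)) x)) ^+ 2)).
  by rewrite ler_pXn2r ?nnegrE ?oh_norm_ge0 ?rho0 ?mxnorm_ge0.
by apply: ohle_oh_norm => //; apply/(ohle_pad ip r).
Qed.

Lemma nrm_shifted n a : (0 < n)%N -> nrm (shifted n a) <= omega `[a].
Proof.
move=> n0; rewrite -(@ler_pXn2r _ 2) ?nnegrE ?ipnorm_ge0 ?omega0 ?mxnorm_ge0 //.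
rewrite (ipnorm_sqr ip); apply: (ohle_const ip).
have := shifted_upper (const_mx a : 'M[X]_1) n0 n0.
by rewrite map_const_mx.
Qed.

(** A power of two, for the Sylvester matrix, and also the square of [N = 2 ^ m], so that the factor
    which makes [h] unitary is the inverse of a whole number of steps. *)
Definition sqsize m := ((2 ^ m) ^ 2)%N.

Lemma sqsize_gt0 m : (0 < sqsize m)%N.
Proof. by rewrite !expn_gt0. Qed.

Lemma leq_sqsize m : (m <= sqsize m)%N.
Proof.
rewrite /sqsize -expnM muln2; apply: leq_trans (ltnW (ltn_expl _ (ltnSn 1))) _.
by rewrite leq_exp2l // -addnn leq_addr.
Qed.

Definition approx m : X -> l2I := shifted (sqsize m).

Lemma approx0 m : approx m 0 = 0.
Proof. by rewrite /approx /shifted subrr. Qed.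

Lemma nrm_approx m a : nrm (approx m a) <= omega `[a].
Proof. exact: nrm_shifted (sqsize_gt0 m). Qed.

Lemma approx_second_difference m a b :
  (2 ^+ m) * nrm (approx m (a + b) + approx m (a - b) - 2 *: approx m a) <=
  2 * omega `[b] + omega `[a + b] + omega `[a - b].
Proof.
have [n [h [nE h1 hh sh]]] := @sylvester_matrix R (m * 2).
have nE' : n = sqsize m by rewrite nE expnM.
have fom (x y : 'M[X]_n) : mxnorm (x - y) = `[b] ->
    oh_norm (map_mx (f (sqsize m)) x - map_mx (f (sqsize m)) y) <= omega `[b].
  move=> xy; rewrite -nE' -xy.
  have n0 : (0 < n)%N by rewrite nE' sqsize_gt0.
  by have /andP[] := coarse x y n0.
have := @second_difference_bound R I X n (2 ^ m) h (f (sqsize m)) (omega `[b]) a b.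
rewrite expn_gt0 => /(_ isT nE' h1 hh sh fom); rewrite natrX.
have -> : approx m (a + b) + approx m (a - b) - 2 *: approx m a =
    f (sqsize m) (a + b) + f (sqsize m) (a - b) - 2 *: f (sqsize m) a.
  by apply: l2_ext => i; rewrite !(l2_valD, l2_valZ, l2_valN); ring.
move=> h2; apply: le_trans h2 _; rewrite -addrA lerD2l.
have -> : f (sqsize m) (a + b) - f (sqsize m) (a - b) = approx m (a + b) - approx m (a - b).
  by apply: l2_ext => i; rewrite !(l2_valD, l2_valZ, l2_valN); ring.
by apply: le_trans (ipnormB ip _ _) _; rewrite lerD ?nrm_approx.
Qed.

Definition asym (x y : nat -> l2I) : Prop :=
  exists K : R, forall m, nrm (x m - y m) <= K / 2 ^+ m.

Lemma pow2_gt0 m : 0 < 2 ^+ m :> R.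
Proof. by rewrite exprn_gt0. Qed.

Lemma asymD x y x' y' : asym x y -> asym x' y' ->
  asym (fun m => x m + x' m) (fun m => y m + y' m).
Proof.
move=> [K hK] [L hL]; exists (K + L) => m; rewrite mulrDl opprD addrACA.
by apply: le_trans (ipnormD ip _ _) _; rewrite lerD.
Qed.

Lemma asymZ a x y : asym x y -> asym (fun m => a *: x m) (fun m => a *: y m).
Proof.
move=> [K hK]; exists (rnorm a * K) => m; rewrite -scalerBr (ipnormZ ip) -mulrA.
by rewrite ler_wpM2l ?rnorm_ge0.
Qed.

Lemma asym_eq x y x' y' : asym x y -> x' =1 x -> y' =1 y -> asym x' y'.
Proof. by move=> [K hK] xx yy; exists K => m; rewrite xx yy. Qed.

(** The pairs [(a + b, 0)] and [(a, b)] have the same midpoint [h]. Subtracting their second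
    differences cancels the value at [h], and [approx m 0 = 0]. *)
Lemma approx_additive a b : asym (fun m => approx m (a + b)) (fun m => approx m a + approx m b).
Proof.
pose h := (2^-1 : C) *: (a + b); pose d := (2^-1 : C) *: (a - b).
have [E1 E2 E3] : [/\ h + d = a, h - d = b & h + h = a + b].
  rewrite /h /d -scalerDr -scalerBr -scalerDr.
  have half (v : X) : (2^-1 : C) *: (v + v) = v.
    by rewrite scalerDr -scalerDl (_ : _ + _ = 1) ?scale1r //; field.
  split; rewrite ?half //.
    by rewrite addrACA subrr addr0 half.
  by rewrite opprB addrACA [b + _]addrC addrACA subrr add0r half.
exists ((2 * omega `[h] + omega `[h + h] + omega `[h - h]) +
  (2 * omega `[d] + omega `[h + d] + omega `[h - d])) => m.
rewrite ler_pdivlMr ?pow2_gt0 // mulrC.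
have -> : approx m (a + b) - (approx m a + approx m b) =
   (approx m (h + h) + approx m (h - h) - 2 *: approx m h)
   - (approx m (h + d) + approx m (h - d) - 2 *: approx m h).
  rewrite E1 E2 E3 subrr approx0 addr0.
  by apply: l2_ext => i; rewrite !(l2_valD, l2_valZ, l2_valN); ring.
apply: (@le_trans _ _ (2 ^+ m * (nrm (approx m (h + h) + approx m (h - h) - 2 *: approx m h) +
   nrm (approx m (h + d) + approx m (h - d) - 2 *: approx m h)))).
  by rewrite ler_wpM2l ?exprn_ge0 //; exact: ipnormB ip _ _.
by rewrite mulrDr lerD ?approx_second_difference.
Qed.

(* Complex linear and conjugate linear parts, up to the defect of [approx m]. *)
Definition clin m (a : X) : l2I := (2^-1 : C) *: (approx m a - 'i *: approx m ('i *: a)).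
Definition alin m (a : X) : l2I := (2^-1 : C) *: (approx m a + 'i *: approx m ('i *: a)).

Lemma clin_alin m a : clin m a + alin m a = approx m a.
Proof. by apply: l2_ext => i; rewrite !(l2_valD, l2_valZ, l2_valN); field. Qed.

Lemma const_norm_unit u a : rnorm u = 1 -> `[u *: a] = `[a].
Proof. by move=> u1; rewrite -map_const_mx mxnormZ u1 mul1r. Qed.

Lemma nrm_half (x y : l2I) c :
  nrm x <= c -> nrm y <= c -> nrm ((2^-1 : C) *: (x + y)) <= c.
Proof.
move=> xc yc; rewrite (ipnormZ ip) rnorm_half.
by have := ipnormD ip x y; lra.
Qed.

Lemma nrm_approx_i m a (u : C) : rnorm u = 1 -> nrm (u *: approx m ('i *: a)) <= omega `[a].
Proof.
move=> u1; rewrite (ipnormZ ip) u1 mul1r; apply: le_trans (nrm_approx _ _) _.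
by rewrite const_norm_unit // rnorm_i.
Qed.

Lemma nrm_clin m a : nrm (clin m a) <= omega `[a].
Proof.
rewrite /clin -scaleNr; apply: nrm_half; first exact: nrm_approx.
by apply: nrm_approx_i; rewrite rnormN rnorm_i.
Qed.

Lemma nrm_alin m a : nrm (alin m a) <= omega `[a].
Proof.
by apply: nrm_half; [exact: nrm_approx|apply: nrm_approx_i; rewrite rnorm_i].
Qed.

Lemma clin_additive a b : asym (fun m => clin m (a + b)) (fun m => clin m a + clin m b).
Proof.
have h := asymZ (2^-1) (asymD (approx_additive a b)
  (asymZ (- 'i) (approx_additive ('i *: a) ('i *: b)))).
apply: asym_eq h _ _ => m; rewrite /clin.
  by rewrite (scalerDr 'i a b) scaleNr.
by apply: l2_ext => i; rewrite !(l2_valD, l2_valZ, l2_valN); ring.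
Qed.

Lemma alin_additive a b : asym (fun m => alin m (a + b)) (fun m => alin m a + alin m b).
Proof.
have h := asymZ (2^-1) (asymD (approx_additive a b)
  (asymZ 'i (approx_additive ('i *: a) ('i *: b)))).
apply: asym_eq h _ _ => m; rewrite /alin.
  by rewrite (scalerDr 'i a b).
by apply: l2_ext => i; rewrite !(l2_valD, l2_valZ, l2_valN); ring.
Qed.

Lemma ii_scale (a : X) : 'i *: ('i *: a) = - a.
Proof. by rewrite scalerA -expr2 sqrCi scaleN1r. Qed.

Lemma approx_opp a : asym (fun m => approx m (- a)) (fun m => - approx m a).
Proof.
have [K hK] := approx_additive a (- a); exists K => m.
rewrite -[X in X <= _](ipnormN ip); apply: le_trans (hK m).
rewrite le_eqVlt; apply/orP; left; apply/eqP; congr nrm.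
by rewrite subrr approx0; apply: l2_ext => i; rewrite !(l2_valD, l2_valZ, l2_valN); ring.
Qed.

Lemma asym_refl x : asym x x.
Proof. by exists 0 => m; rewrite subrr (ipnorm0 ip) mul0r. Qed.

(** Multiplying twice by ['i] gives [- a], so the only defect is that of [approx m (- a)] against
    [- approx m a]. *)
Lemma clin_i a : asym (fun m => clin m ('i *: a)) (fun m => 'i *: clin m a).
Proof.
have h := asymZ (2^-1) (asymD (asym_refl (fun m => approx m ('i *: a)))
  (asymZ (- 'i) (approx_opp a))).
apply: asym_eq h _ _ => m; rewrite /clin.
  by rewrite ii_scale scaleNr.
move: (approx m a) (approx m ('i *: a)) => x y.
apply: l2_ext => i; rewrite !(l2_valD, l2_valZ, l2_valN).
move: (l2_val x i) (l2_val y i) => v w.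
have -> : 'i * (2^-1 * (v - 'i * w)) = 2^-1 * ('i * v - ('i * 'i) * w) :> C by ring.
by rewrite -expr2 sqrCi; ring.
Qed.

Lemma alin_i a : asym (fun m => alin m ('i *: a)) (fun m => (- 'i) *: alin m a).
Proof.
have h := asymZ (2^-1) (asymD (asym_refl (fun m => approx m ('i *: a))) (asymZ 'i (approx_opp a))).
apply: asym_eq h _ _ => m; rewrite /alin.
  by rewrite ii_scale.
move: (approx m a) (approx m ('i *: a)) => x y.
apply: l2_ext => i; rewrite !(l2_valD, l2_valZ, l2_valN).
move: (l2_val x i) (l2_val y i) => v w.
have -> : - 'i * (2^-1 * (v + 'i * w)) = 2^-1 * (- ('i * v) - ('i * 'i) * w) :> C by ring.
by rewrite -expr2 sqrCi; ring.
Qed.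

(* The conjugation makes the conjugate linear part contribute a form which is
   linear in [a]. *)
Definition pre_ip m a b : C :=
  l2_ip (clin m a) (clin m b) + (l2_ip (alin m a) (alin m b))^*.

Lemma pre_ipC m a b : pre_ip m b a = (pre_ip m a b)^*.
Proof.
by rewrite /pre_ip rmorphD /= (ipC ip (clin m a)) (ipC ip (alin m a)).
Qed.

Lemma pre_ip_ge0 m a : 0 <= pre_ip m a a.
Proof.
rewrite /pre_ip !(sqnormE ip) conj_Creal ?complex_real // -rmorphD ler0c.
by rewrite addr_ge0 ?(sqnorm_ge0 ip).
Qed.

Lemma clin_ip_bounded m a b :
  rnorm (l2_ip (clin m a) (clin m b)) <= omega `[a] * omega `[b].
Proof.
apply: le_trans (cauchy_schwarz ip _ _) _.
exact: ler_pM (ipnorm_ge0 _ _) (ipnorm_ge0 _ _) (nrm_clin _ _) (nrm_clin _ _).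
Qed.

Lemma alin_ip_bounded m a b :
  rnorm (l2_ip (alin m a) (alin m b)) <= omega `[a] * omega `[b].
Proof.
apply: le_trans (cauchy_schwarz ip _ _) _.
exact: ler_pM (ipnorm_ge0 _ _) (ipnorm_ge0 _ _) (nrm_alin _ _) (nrm_alin _ _).
Qed.

Lemma pre_ip_bounded m a b : rnorm (pre_ip m a b) <= 2 * (omega `[a] * omega `[b]).
Proof.
apply: le_trans (rnormD _ _) _; rewrite rnorm_conj mulr2n mulrDl !mul1r.
by apply: lerD; [exact: clin_ip_bounded|exact: alin_ip_bounded].
Qed.

Context (U : set_system nat) {UU : UltraFilter U}.
Context (Uoo : forall k, U [set m | (k <= m)%N]).

Lemma small_pow (K e : R) : 0 < e -> U [set m | K / 2 ^+ m < e].
Proof.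
move=> e0; have [k hk] : exists k : nat, K / e < k%:R.
  exists (Num.truncn (`|K / e|)).+1; apply: le_lt_trans (ler_norm _) _.
  exact: truncnS_gt.
apply: (filterS _ (Uoo k)) => m /= km; rewrite ltr_pdivrMr ?pow2_gt0 //.
rewrite mulrC -ltr_pdivrMr //; apply: lt_le_trans hk _.
apply: (@le_trans _ _ m%:R); first by rewrite ler_nat.
by rewrite -natrX ler_nat ltnW // ltn_expl.
Qed.

Lemma asym_ip (x y z : nat -> l2I) M l : asym x y -> (forall m, nrm (z m) <= M) ->
  fcvg U (fun m => l2_ip (y m) (z m)) l -> fcvg U (fun m => l2_ip (x m) (z m)) l.
Proof.
move=> [K hK] zM yl; apply: (@fcvg_null R nat U _ _ _ _ (fun m => K * M / 2 ^+ m) yl).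
  apply: filterE => m /=; rewrite -(ipBl ip); apply: le_trans (cauchy_schwarz ip _ _) _.
  by rewrite mulrAC; exact: ler_pM (ipnorm_ge0 _ _) (ipnorm_ge0 _ _) (hK _) (zM _).
exact: small_pow.
Qed.

(** One ultrafilter serves all pairs [a], [b] at once, so [X] may be nonseparable, and identities
    between the limits can be checked pair by pair. *)
Lemma pre_ip_cvg a b : exists l, fcvg U (fun m => pre_ip m a b) l.
Proof. by apply: ultra_fcvg => m; exact: pre_ip_bounded. Qed.

Definition lim_ip a b : C := projT1 (cid (pre_ip_cvg a b)).

Lemma lim_ipP a b : fcvg U (fun m => pre_ip m a b) (lim_ip a b).
Proof. exact: projT2 (cid (pre_ip_cvg a b)). Qed.

Lemma lim_ipE a b l : fcvg U (fun m => pre_ip m a b) l -> lim_ip a b = l.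
Proof. by move=> h; apply: fcvg_uniq (lim_ipP a b) h. Qed.

Lemma lim_ipC a b : lim_ip b a = (lim_ip a b)^*.
Proof.
by apply: lim_ipE; apply: fcvg_eq (fcvg_conj (lim_ipP a b)) _ => m; exact: pre_ipC.
Qed.

Lemma lim_ip_ge0 a : 0 <= lim_ip a a.
Proof.
by apply: (fcvg_ge0 (lim_ipP a a)); apply: filterE => m; exact: pre_ip_ge0.
Qed.

Lemma lim_ip_bounded a b : rnorm (lim_ip a b) <= 2 * (omega `[a] * omega `[b]).
Proof.
by apply: (fcvg_rnorm_le (lim_ipP a b)); apply: filterE => m; exact: pre_ip_bounded.
Qed.

(** The two parts of [pre_ip] need limits of their own: ['i] acts on them with opposite signs, so
    identities for [lim_ip] are proved part by part. *)
Lemma clin_cvg a b : exists l, fcvg U (fun m => l2_ip (clin m a) (clin m b)) l.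
Proof.
by apply: (@ultra_fcvg R nat U UU _ (omega `[a] * omega `[b])) => m; exact: clin_ip_bounded.
Qed.

Lemma alin_cvg a b : exists l, fcvg U (fun m => l2_ip (alin m a) (alin m b)) l.
Proof.
by apply: (@ultra_fcvg R nat U UU _ (omega `[a] * omega `[b])) => m; exact: alin_ip_bounded.
Qed.

Lemma lim_ipDl a a' b : lim_ip (a + a') b = lim_ip a b + lim_ip a' b.
Proof.
have [[l1 h1] [l2 h2]] := (clin_cvg a b, clin_cvg a' b).
have [[k1 e1] [k2 e2]] := (alin_cvg a b, alin_cvg a' b).
rewrite (lim_ipE (fcvgD h1 (fcvg_conj e1))) (lim_ipE (fcvgD h2 (fcvg_conj e2))).
rewrite addrACA -rmorphD; apply: lim_ipE; apply: fcvgD; last apply: fcvg_conj.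
  apply: (asym_ip (clin_additive a a') (fun m => nrm_clin m b)).
  by apply: fcvg_eq (fcvgD h1 h2) _ => m; rewrite (ipDl ip).
apply: (asym_ip (alin_additive a a') (fun m => nrm_alin m b)).
by apply: fcvg_eq (fcvgD e1 e2) _ => m; rewrite (ipDl ip).
Qed.

Lemma lim_ip_il a b : lim_ip ('i *: a) b = 'i * lim_ip a b.
Proof.
have [[l1 h1] [k1 e1]] := (clin_cvg a b, alin_cvg a b).
rewrite (lim_ipE (fcvgD h1 (fcvg_conj e1))).
rewrite mulrDr (_ : 'i * k1^* = (- 'i * k1)^*); last first.
  by rewrite rmorphM rmorphN /= conjCi opprK.
apply: lim_ipE; apply: fcvgD; last apply: fcvg_conj.
  apply: (asym_ip (clin_i a) (fun m => nrm_clin m b)).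
  by apply: fcvg_eq (fcvgZ 'i h1) _ => m; rewrite (ipZl ip).
apply: (asym_ip (alin_i a) (fun m => nrm_alin m b)).
by apply: fcvg_eq (fcvgZ (- 'i) e1) _ => m; rewrite (ipZl ip).
Qed.

(* [omega] may be unbounded near 0, so the bound of [lim_ip (s *: a) b] for
   [0 <= s <= 1] comes from writing [2 s] as a sum of two complex numbers of
   modulus 1, which leave the norm of [a] unchanged. *)
Lemma lim_ip_real t a b : lim_ip (toC t *: a) b = toC t * lim_ip a b.
Proof.
pose phi s := lim_ip (toC s *: a) b.
have phi1 : phi 1 = lim_ip a b by rewrite /phi scale1r.
rewrite -phi1; apply: (@additive_bounded_linear R phi (2 * (omega `[a] * omega `[b])))
  => [s s'|s /andP[s0 s1]]; rewrite /phi.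
  by rewrite rmorphD scalerDl lim_ipDl.
have [|u [v [u1 v1 uE]]] := @unit_average R s; first by rewrite s0.
have avg (z z1 z2 : C) M : z + z = z1 + z2 -> rnorm z1 <= M -> rnorm z2 <= M ->
    rnorm z <= M.
  move=> zE; have := rnorm_double z; have := rnormD z1 z2; rewrite zE; lra.
apply: (avg _ (lim_ip (u *: a) b) (lim_ip (v *: a) b)).
- apply: etrans (esym (lim_ipDl (toC s *: a) (toC s *: a) b)) _.
  have -> : toC s *: a + toC s *: a = u *: a + v *: a.
    by rewrite -(scalerDl a (toC s)) -(scalerDl a u) uE.
  exact: lim_ipDl (u *: a) (v *: a) b.
- by rewrite -[in leRHS](const_norm_unit a u1); exact: lim_ip_bounded.
- by rewrite -[in leRHS](const_norm_unit a v1); exact: lim_ip_bounded.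
Qed.

Lemma lim_inner_product : inner_product lim_ip.
Proof.
split; [|exact: lim_ipC|exact: lim_ip_ge0].
move=> z a a' b; rewrite lim_ipDl; congr (_ + _).
rewrite {1}[z]complexE complexiE scalerDl lim_ipDl -scalerA lim_ip_il !lim_ip_real.
by rewrite {3}[z]complexE complexiE; ring.
Qed.

(** Common to [clin] ([u = - 'i]) and [alin] ([u = 'i]). No constant is lost: the two factors 2 of
    [ohleD] are compensated by the square of [2^-1]. *)
Lemma half_combination_upper m k (x : 'M[X]_k) (u : C) : (k <= sqsize m)%N ->
  rnorm u = 1 ->
  ohle (@l2_ip R I) (map_mx ( *:%R (2^-1 : C))
    (map_mx (approx m) x + map_mx ( *:%R u) (map_mx (approx m) (map_mx ( *:%R 'i) x))))
    (omega (mxnorm x) ^+ 2).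
Proof.
move=> km u1; have s0 := sqsize_gt0 m.
have h1 := shifted_upper x km s0.
have h2 := shifted_upper (map_mx ( *:%R ('i : C)) x) km s0.
rewrite mxnormZ rnorm_i mul1r in h2.
have := ohleZ ip (2^-1) (ohleD ip h1 (ohleZ ip u h2)); rewrite u1 rnorm_half.
by apply: ohle_le; rewrite le_eqVlt; apply/orP; left; apply/eqP; field.
Qed.

Lemma clin_upper m k (x : 'M[X]_k) : (k <= sqsize m)%N ->
  ohle (@l2_ip R I) (map_mx (clin m) x) (omega (mxnorm x) ^+ 2).
Proof.
move=> km; have := @half_combination_upper m k x (- 'i) km.
rewrite rnormN rnorm_i => /(_ erefl); congr ohle; apply/matrixP => i j.
by rewrite !mxE /clin scaleNr.
Qed.

Lemma alin_upper m k (x : 'M[X]_k) : (k <= sqsize m)%N ->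
  ohle (@l2_ip R I) (map_mx (alin m) x) (omega (mxnorm x) ^+ 2).
Proof.
move=> km; have := @half_combination_upper m k x 'i km.
rewrite rnorm_i => /(_ erefl); congr ohle; apply/matrixP => i j.
by rewrite !mxE.
Qed.

(* Exchanging the two tensor factors absorbs the conjugation of [pre_ip]. *)
Lemma oform_pre_ip m k (x : 'M[X]_k) (V W : 'M[C]_k) :
  oform (pre_ip m) x V W = oform (@l2_ip R I) (map_mx (clin m) x) V W
    + oform (@l2_ip R I) (map_mx (alin m) x) V^T W^T.
Proof.
rewrite {3}/oform [X in _ + X]exchange_big /= /oform -big_split; apply: eq_bigr => i _.
rewrite -big_split; apply: eq_bigr => i' _ /=.
rewrite [X in _ + X]exchange_big -big_split; apply: eq_bigr => j _.
rewrite -big_split; apply: eq_bigr => j' _ /=.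
by rewrite !mxE /pre_ip -(ipC ip) !mulrDl.
Qed.

Lemma tr_outer n p (A : 'M[C]_(n, p)) : (outer A)^T = outer (map_mx Num.conj A).
Proof.
apply/matrixP => i j; rewrite !mxE; apply: eq_bigr => s _.
by rewrite !mxE conjCK mulrC.
Qed.

Lemma hsnorm_tr n (V : 'M[C]_n) : hsnorm V^T = hsnorm V.
Proof.
rewrite /hsnorm exchange_big; congr Num.sqrt.
by apply: eq_bigr => i _; apply: eq_bigr => j _; rewrite mxE.
Qed.

Lemma pre_ip_upper m k (x : 'M[X]_k) : (k <= sqsize m)%N ->
  ohle (pre_ip m) x (2 * omega (mxnorm x) ^+ 2).
Proof.
move=> km p q A B; rewrite oform_pre_ip cReD !tr_outer.
have h1 := clin_upper x km A B.
have := alin_upper x km (map_mx Num.conj A) (map_mx Num.conj B).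
rewrite -!tr_outer !hsnorm_tr; lra.
Qed.

(** At matrices of the form [outer] both summands of [oform_pre_ip] are nonnegative, so each obeys
    the bound for their sum, and [approx] is recovered as [clin + alin]. Here 64 is 4 * 16, with 4
    from [ohleD] and 16 from [shifted_lower]. *)
Lemma pre_ip_lower m k (x : 'M[X]_k) c : (k <= sqsize m)%N -> 0 <= c ->
  ohle (pre_ip m) x c -> rho (mxnorm x) ^+ 2 <= 64 * c.
Proof.
move=> km c0 xc.
have oge0 h p q (A : 'M[C]_(k, p)) (B : 'M[C]_(k, q)) :
    0 <= complex.Re (oform (@l2_ip R I) (map_mx h x) (outer A) (outer B)).
  by have h0 := oform_outer_ge0 ip (map_mx h x) A B; rewrite -ler0c -(ge0_toC h0).
have h1 : ohle (@l2_ip R I) (map_mx (clin m) x) c.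
  move=> p q A B; apply: le_trans (xc _ _ A B).
  by rewrite oform_pre_ip cReD !tr_outer lerDl oge0.
have h2 : ohle (@l2_ip R I) (map_mx (alin m) x) c.
  (* Testing with the conjugates of [A] and [B] cancels the transposes in [oform_pre_ip]. *)
  move=> p q A B; have := xc _ _ (map_mx Num.conj A) (map_mx Num.conj B).
  rewrite -!tr_outer !hsnorm_tr; apply: le_trans.
  by rewrite oform_pre_ip !trmxK cReD lerDr !tr_outer oge0.
have := ohleD ip h1 h2.
have -> : map_mx (clin m) x + map_mx (alin m) x = map_mx (approx m) x.
  by apply/matrixP => i j; rewrite !mxE clin_alin.
move=> h; have cc : 0 <= 2 * c + 2 * c by lra.
by have := shifted_lower km (sqsize_gt0 m) cc h; lra.
Qed.

Lemma oform_lim k (x : 'M[X]_k) (V W : 'M[C]_k) :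
  fcvg U (fun m => oform (pre_ip m) x V W) (oform lim_ip x V W).
Proof.
have cvgM (u : nat -> C) l a b : fcvg U u l -> fcvg U (fun m => u m * a * b) (l * a * b).
  move=> ul; have -> : l * a * b = (a * b) * l by ring.
  by apply: fcvg_eq (fcvgZ (a * b) ul) _ => m; ring.
by do 4![apply: fcvg_sum => ?]; exact: cvgM (lim_ipP _ _).
Qed.

Lemma lim_ip_upper_pointwise k (x : 'M[X]_k) :
  ohle lim_ip x (2 * omega (mxnorm x) ^+ 2).
Proof.
move=> p q A B; apply: (fcvg_Re_le (oform_lim x (outer A) (outer B))).
apply: (filterS _ (Uoo k)) => m /= km.
exact: (pre_ip_upper x (leq_trans km (leq_sqsize m))).
Qed.

(** As [omega] need not be monotone, [omega (mxnorm x)] says nothing about [omega 1]. Instead [x] is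
    normalized to norm 1 and the homogeneity of the limit form is used; [x = 0] is separate. *)
Lemma lim_ip_upper k (x : 'M[X]_k) : mxnorm x <= 1 ->
  ohle lim_ip x (2 * omega 1 ^+ 2).
Proof.
move=> x1; have := mxnorm_ge0 x; rewrite le_eqVlt => /orP[/eqP x0|x0].
  have -> : x = 0 by exact: mxnorm_eq0.
  move=> p q A B; rewrite /oform big1 /=.
    by apply: mulr_ge0; apply: mulr_ge0; rewrite ?sqr_ge0 ?hsnorm_ge0.
  move=> i _; do 3![rewrite big1 // => ? _]; rewrite mxE.
  by rewrite (ip0l lim_inner_product) !mul0r.
set s := mxnorm x in x0 x1 *.
pose y := map_mx ( *:%R (toC s^-1)) x.
have y1 : mxnorm y = 1.
  by rewrite mxnormZ rnorm_real ger0_norm ?invr_ge0 ?ltW // mulVf ?gt_eqF.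
have -> : x = map_mx ( *:%R (toC s)) y.
  apply/matrixP => i j; rewrite !mxE scalerA -rmorphM mulfV ?gt_eqF //.
  by rewrite rmorph1 scale1r.
have := lim_ip_upper_pointwise y; rewrite y1.
move/(ohleZ lim_inner_product (toC s)); apply: ohle_le.
rewrite rnorm_real (ger0_norm (ltW x0)); have o0 := sqr_ge0 (omega 1).
have s2 : s ^+ 2 <= 1 by rewrite expr_le1 // (ltW x0).
have : 0 <= s ^+ 2 by exact: sqr_ge0.
move: (s ^+ 2) s2 (omega 1 ^+ 2) o0 => a a1 b b0 a0; nra.
Qed.

(** One [m] must serve all test matrices, of which there are infinitely many. Only the [k ^ 4] pairs
    of entries of [x] matter: the difference of the forms is at most the sum of the differences at
    these pairs times both Hilbert-Schmidt norms. *)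
Lemma lim_ip_close k (x : 'M[X]_k) c e : 0 < e -> ohle lim_ip x c ->
  exists2 m, (k <= sqsize m)%N & ohle (pre_ip m) x (c + e).
Proof.
move=> e0 xc; pose N : R := (k * k * (k * k)).+1%:R.
have N0 : 0 < N by rewrite ltr0n.
have eN : 0 < e / N by rewrite divr_gt0.
pose J : finType := (('I_k * 'I_k) * ('I_k * 'I_k))%type.
pose close (j : J) : set nat := [set m |
  rnorm (pre_ip m (x j.1.1 j.1.2) (x j.2.1 j.2.2)
         - lim_ip (x j.1.1 j.1.2) (x j.2.1 j.2.2)) < e / N].
have UF : Filter U by exact: filter_filter.
have Uc : U [set m | forall j, close j m].
  by apply: (@filter_forall _ _ close _ UF) => j; exact: lim_ipP.
have [m [/= mc km]] := filter_ex (filterI Uc (Uoo k)).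
exists m; first exact: leq_trans km (leq_sqsize m).
move=> p q A B; set V := outer A; set W := outer B.
have -> : complex.Re (oform (pre_ip m) x V W) =
  complex.Re (oform lim_ip x V W) + complex.Re (oform (pre_ip m) x V W - oform lim_ip x V W).
  by rewrite cReB addrC subrK.
rewrite mulrDl lerD ?xc //; apply: le_trans (Re_le_rnorm _) _.
have -> : oform (pre_ip m) x V W - oform lim_ip x V W =
    oform (fun a b => pre_ip m a b - lim_ip a b) x V W.
  rewrite /oform; do 4![rewrite -sumrB; apply: eq_bigr => ? _].
  by rewrite !mulrBl.
have hVW : 0 <= hsnorm V * hsnorm W by rewrite mulr_ge0 ?hsnorm_ge0.
apply: (@le_trans _ _ (\sum_(i < k) \sum_(i' < k) \sum_(j < k) \sum_(j' < k)
   e / N * (hsnorm V * hsnorm W))).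
  rewrite /oform; do 4![apply: le_trans (rnorm_sum _ _ _) _; apply: ler_sum => ? _].
  rewrite !rnormM rnorm_conj -mulrA; apply: ler_pM; rewrite ?mulr_ge0 ?rnorm_ge0 //.
    by apply: ltW; exact: (mc ((_, _), (_, _))).
  by apply: ler_pM; rewrite ?rnorm_ge0 ?rnorm_le_hsnorm.
rewrite !sumr_const !card_ord -!mulrnA -mulr_natl.
rewrite mulrA [X in X * _]mulrA ler_wpM2r // ler_pdivrMr // mulrC ler_wpM2l ?(ltW e0) //.
by rewrite ler_nat mulnA leqnSn.
Qed.

Lemma lim_ip_lower_pointwise k (x : 'M[X]_k) c : 0 <= c ->
  ohle lim_ip x c -> rho (mxnorm x) ^+ 2 <= 64 * c.
Proof.
move=> c0 xc; apply/ler_addgt0Pl => e e0.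
have e64 : 0 < e / 64 by rewrite divr_gt0.
have [m km xm] := lim_ip_close e64 xc.
have ce : 0 <= c + e / 64 by rewrite addr_ge0 // ltW.
by have := pre_ip_lower km ce xm; lra.
Qed.

Lemma lim_ip_lower : exists2 M : R, 0 <= M & forall k (x : 'M[X]_k),
  ohle lim_ip x 1 -> mxnorm x <= M.
Proof.
(* Any number above 8 would do in place of 9: its square has to exceed the constant 64 of
   [lim_ip_lower_pointwise]. *)
have [M [_ hM]] : \forall t \near +oo, 9 <= rho t.
  by move/cvgryPge : rho_oo; apply.
exists `|M| => // k x x1; rewrite leNgt; apply/negP => Mx.
have h9 : 9 <= rho (mxnorm x) by apply: hM; apply: le_lt_trans Mx; exact: ler_norm.
have := lim_ip_lower_pointwise ler01 x1; rewrite mulr1 => h64.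
have : 9 * 9 <= rho (mxnorm x) ^+ 2 by rewrite expr2 ler_pM.
by lra.
Qed.

End LinearDefect.

Lemma renorming_inner_product (R : realType) (I : choiceType) (X : opspace R) :
  almost_completely_coarsely_embeds X (OH R I) ->
  exists S : X -> X -> R[i], [/\ inner_product S,
    exists2 c : R, 0 <= c & forall k (x : 'M[X]_k), mxnorm x <= 1 -> ohle S x c
  & exists2 M : R, 0 <= M & forall k (x : 'M[X]_k), ohle S x 1 -> mxnorm x <= M].
Proof.
move=> [omega [rho [f [omega0 rho0 rho_oo coarse]]]].
have [U [UU Uoo]] := ultraFilterLemma (@eventually_filter).
have Uk k : U [set m | (k <= m)%N] by apply: Uoo; exists k.
have coarse' (n : nat) (x y : 'M[X]_n) : (0 < n)%N ->
  rho (mxnorm (x - y)) <= oh_norm (map_mx (f n) x - map_mx (f n) y)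
    <= omega (mxnorm (x - y)) by exact: coarse.
exists (lim_ip omega0 coarse' (U := U)); split.
- exact: lim_inner_product.
- exists (2 * omega 1 ^+ 2); first by rewrite mulr_ge0 ?sqr_ge0.
  by move=> k x; exact: lim_ip_upper.
- exact: lim_ip_lower.
Qed.

(** * Orthonormal bases *)

Section Completeness.
Context {R : realType} (X : opspace R).
Local Notation C := R[i].
Local Notation toC := (real_complex R).
Local Notation H := (os_hilbert X).
Local Notation "`[ a ]" := (mxnorm (const_mx a : 'M[X]_1)).

Lemma hilbert_complete (x : nat -> H) :
  (forall e : R, 0 < e -> exists N, forall i j, (N <= i)%N -> (N <= j)%N ->
     rnorm (x i - x j) <= e) ->
  exists l, forall e : R, 0 < e -> exists N, forall i, (N <= i)%N ->
     rnorm (x i - l) <= e.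
Proof.
move=> xc.
have : cauchy (x @ \oo).
  apply/cauchyP => e e0.
  (* The radii of balls are elements of [C]; a positive one is real. *)
  have eE : e = toC (complex.Re e) by apply: ge0_toC; exact: ltW.
  have r0 : 0 < complex.Re e / 2 by rewrite divr_gt0 // -ltcR -eE.
  have [N hN] := xc _ r0; exists (x N); exists N => // i /= Ni.
  rewrite -ball_normE /= eE rnormE ltcR; apply: le_lt_trans (hN _ _ _ _) _ => //.
  by lra.
move=> /cauchy_cvg /cvg_ex[l xl]; exists l => e e0.
have e0' : 0 < toC e by rewrite ltcR.
have [N _ hN] := (cvgrPdist_lt _ _).1 xl _ e0'.
by exists N => i Ni; have := hN i Ni; rewrite /= rnormE ltcR rnormB => /ltW.
Qed.

(** The pointwise limit [T] is also the limit in operator norm, because the Cauchy bound is uniform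
    in the vector; only then does [os_closed] place [T] in the space. *)
Lemma opspace_complete (u : nat -> X) :
  (forall e : R, 0 < e -> exists N, forall i j, (N <= i)%N -> (N <= j)%N ->
     `[u i - u j] <= e) ->
  exists a, forall e : R, 0 < e -> exists N, forall i, (N <= i)%N -> `[u i - a] <= e.
Proof.
move=> uc.
have lims (z : H) : exists l, forall e : R, 0 < e -> exists N, forall i, (N <= i)%N ->
     rnorm (os_val (u i) z - l) <= e.
  apply: hilbert_complete => e e0.
  have z1 : 0 < rnorm z + 1 by rewrite ltr_wpDl ?rnorm_ge0.
  have [N hN] := uc (e / (rnorm z + 1)) (divr_gt0 e0 z1).
  exists N => i j Ni Nj; have := rnorm_os_val (u i - u j) z.
  rewrite os_valD os_valN => h; apply: le_trans h _.
  apply: le_trans (ler_wpM2r (rnorm_ge0 z) (hN _ _ Ni Nj)) _.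
  by rewrite mulrAC ler_pdivrMr // ler_wpM2l ?(ltW e0) // lerDl.
have [T hT] := choice lims.
(* [N] depends on [e] only; the later index used for comparison may depend on [z], since it
   disappears from the estimate. *)
have unif (e : R) : 0 < e -> exists N, forall i, (N <= i)%N -> forall z,
    rnorm (os_val (u i) z - T z) <= e * rnorm z.
  move=> e0; have [N hN] := uc e e0; exists N => i Ni z.
  apply/ler_addgt0Pl => d d0; have [M hM] := hT z d d0.
  have [jN jM] : (N <= maxn N M)%N /\ (M <= maxn N M)%N by rewrite leq_maxl leq_maxr.
  rewrite -[os_val (u i) z](subrK (os_val (u (maxn N M)) z)) -addrA.
  apply: le_trans (rnormD _ _) _; rewrite [leLHS]addrC; apply: lerD; first exact: hM.
  have := rnorm_os_val (u i - u (maxn N M)) z; rewrite os_valD os_valN => h.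
  by apply: le_trans h _; rewrite ler_wpM2r ?rnorm_ge0 // hN.
(* [T] was chosen pointwise, so its linearity rests on the uniqueness of limits. *)
have uniq (z l : H) : (forall e : R, 0 < e -> exists N, forall i, (N <= i)%N ->
    rnorm (os_val (u i) z - l) <= e) -> l = T z.
  move=> hl; apply/eqP; rewrite -subr_eq0 -rnorm_eq0; apply/eqP/le_anti.
  rewrite rnorm_ge0 andbT; apply/ler_addgt0Pl => e e0; rewrite addr0.
  have e20 : 0 < e / 2 by rewrite divr_gt0.
  have [[N hN] [M hM]] := (hl _ e20, hT z _ e20).
  have := hM _ (leq_maxr N M); have := hN _ (leq_maxl N M).
  set w := os_val _ z => h1 h2.
  rewrite (_ : l - T z = (w - T z) - (w - l)); last by rewrite opprB [RHS]addrC addrA subrK.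
  by apply: le_trans (rnormD _ _) _; rewrite rnormN; lra.
have Tlin : linear T.
  move=> a z w; apply: esym; apply: uniq => e e0.
  have a1 : 0 < rnorm a + 1 by rewrite ltr_wpDl ?rnorm_ge0.
  have ea : 0 < e / 2 / (rnorm a + 1) by rewrite !divr_gt0.
  have e20 : 0 < e / 2 by rewrite divr_gt0.
  have [[N hN] [M hM]] := (hT z _ ea, hT w _ e20).
  exists (maxn N M) => i; rewrite geq_max => /andP[/hN h1 /hM h2].
  rewrite os_val_lin opprD addrACA -scalerBr; apply: le_trans (rnormD _ _) _.
  rewrite rnormZ [leRHS](splitr e) lerD //.
  have r0 := rnorm_ge0 (os_val (u i) z - T z).
  move: h1; rewrite ler_pdivlMr //; have := rnorm_ge0 a; nra.
have [N1 hN1] := unif 1 ltr01.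
have Tb : bounded_operators H T.
  split; first exact: Tlin.
  have [_ [M hM]] := os_val_bounded (u N1); exists (M + 1) => z.
  rewrite (_ : T z = os_val (u N1) z - (os_val (u N1) z - T z)); last by rewrite subKr.
  apply: le_trans (rnormD _ _) _; rewrite rnormN mulrDl lerD //.
  exact: hN1.
have homr : homogeneous (fun l (z : H) => l *: z) (@rnorm R H).
  by split; [exact: rnorm_ge0|exact: rnormZ].
have Tset : os_set T.
  apply: (@os_closed R X (fun k => os_val (u k)) T Tb).
    by move=> k; apply/asboolP; exact: os_valP.
  apply/cvgrPdist_le => e e0; have [N hN] := unif e e0.
  exists N => // i /= Ni; rewrite sub0r normrN ger0_norm.
    by apply: (opnorm_le 0 homr (ltW e0)) => z; exact: hN.
  by apply: (@opnorm_ge0 R _ _ _ _ 0 _ _ homr homr _ e) => z; exact: hN.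
have TP : T \in os_pred (X := X) by apply/asboolP.
exists (OsElt TP) => e e0; have [N hN] := unif e e0; exists N => i Ni.
apply: mxnorm_const_le; first exact: ltW.
by move=> z; exact: hN.
Qed.

End Completeness.

Section OrthonormalBases.
Context {R : realType} (V : lmodType R[i]) (S : V -> V -> R[i]).
Context (ipS : inner_product S).
Local Notation C := R[i].
Local Notation toC := (real_complex R).
Local Notation nrm := (ipnorm S).

Definition orthonormal_set (E : set V) : Prop :=
  forall x y, E x -> E y -> S x y = (x == y)%:R.

(** By Zorn's lemma: an orthogonal vector of nonzero square norm could be normalized and added. The
    form may be degenerate here, hence the conclusion about [sqnorm] instead of [x = 0]. *)
Lemma maximal_orthonormal_set : exists E : set V, orthonormal_set E /\
  forall x, (forall y, E y -> S x y = 0) -> sqnorm S x = 0.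
Proof.
have [F Ft Ftot|E [Eo Emax]] := @Zorn_bigcup V orthonormal_set.
  move=> x y [A FA Ax] [B FB By].
  by have [AB|BA] := Ftot _ _ FA FB; [apply: (Ft _ FB) => //; exact: AB|
    apply: (Ft _ FA) => //; exact: BA].
exists E; split=> // x xE; apply/eqP/negPn/negP => x0.
have xp : 0 < sqnorm S x by rewrite lt_def x0 (sqnorm_ge0 ipS).
pose c := toC (ipnorm S x)^-1; pose z := c *: x.
have zE y : E y -> S z y = 0 by move=> Ey; rewrite (ipZl ipS) xE ?mulr0.
have z1 : S z z = 1.
  rewrite (sqnormE ipS) (sqnormZ ipS) rnorm_real ger0_norm ?invr_ge0 ?ipnorm_ge0 //.
  by rewrite exprVn (ipnorm_sqr ipS) mulVf.
apply: (Emax (E `|` [set z])).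
  split; first by move=> y; left.
  move=> /(_ z (or_intror erefl)) Ez; have := zE z Ez; rewrite z1 => /eqP.
  by rewrite oner_eq0.
have zy y : E y -> (z == y) = false.
  move=> Ey; apply/eqP => zy; have := zE y Ey; rewrite -zy z1 => /eqP.
  by rewrite oner_eq0.
move=> a b [Ea|->] [Eb|->].
- exact: Eo.
- by rewrite (ipC ipS) zE // rmorph0 eq_sym zy.
- by rewrite zE // zy.
- by rewrite z1 eqxx.
Qed.

Context (J : choiceType) (e : J -> V).
Context (eo : forall i j, S (e i) (e j) = (i == j)%:R).
Local Notation l2J := (@l2 R J).

Lemma ip_combination (c : J -> C) (F : {fset J}) j : j \in F ->
  S (\sum_(i <- F) c i *: e i) (e j) = c j.
Proof.
move=> jF; rewrite (ip_suml ipS) (big_fsetD1 j) //= (ipZl ipS) eo eqxx mulr1.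
rewrite big_seq big1 ?addr0 // => i; rewrite !inE => /andP[ij _].
by rewrite (ipZl ipS) eo (negbTE ij) mulr0.
Qed.

Lemma sqnorm_combination (c : J -> C) (F : {fset J}) :
  sqnorm S (\sum_(i <- F) c i *: e i) = \sum_(i <- F) rnorm (c i) ^+ 2.
Proof.
rewrite /sqnorm (ip_sumr ipS) cRe_sum big_seq [RHS]big_seq.
apply: eq_bigr => i iF; rewrite (ipZr ipS) ip_combination // mulrC mulC_conj.
by [].
Qed.

(** For the partial sum [y] one has [S x y = sqnorm S y], so [sqnorm S (x - y)] is
    [sqnorm S x - sqnorm S y]. *)
Lemma bessel x (F : {fset J}) :
  \sum_(i <- F) rnorm (S x (e i)) ^+ 2 <= sqnorm S x.
Proof.
set y := \sum_(i <- F) S x (e i) *: e i.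
have xy : S x y = toC (sqnorm S y).
  rewrite sqnorm_combination (ip_sumr ipS) rmorph_sum; apply: eq_bigr => i _.
  by rewrite (ipZr ipS) mulrC mulC_conj.
have := sqnorm_ge0 ipS (x - y); rewrite (sqnormD ipS) (sqnormN ipS) (ipNr ipS).
by rewrite cReN xy /= sqnorm_combination; lra.
Qed.

Definition total_family : Prop := forall x, (forall j, S x (e j) = 0) -> x = 0.

Definition ip_complete : Prop := forall u : nat -> V,
  (forall d : R, 0 < d -> exists N, forall i j, (N <= i)%N -> (N <= j)%N ->
     nrm (u i - u j) <= d) ->
  exists a, forall d : R, 0 < d -> exists N, forall i, (N <= i)%N -> nrm (u i - a) <= d.

(** [J] may be uncountable while completeness concerns sequences. So finite sets [Fs k] are chosen
    beyond which the partial sums move by at most [1 / (k + 1)], and the limit along this sequence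
    is the limit along all finite sets. *)
Lemma riesz_fischer (y : l2J) : ip_complete -> exists x, forall d : R, 0 < d ->
  exists F : {fset J}, forall G, (F `<=` G)%fset ->
    nrm (\sum_(i <- G) l2_val y i *: e i - x) <= d.
Proof.
move=> Vc; have [s hs] := l2_sum_cvg y.
pose v (F : {fset J}) := \sum_(i <- F) l2_val y i *: e i.
have vFG (F G : {fset J}) : (F `<=` G)%fset ->
    sqnorm S (v G - v F) = \sum_(i <- G) rnorm (l2_val y i) ^+ 2
      - \sum_(i <- F) rnorm (l2_val y i) ^+ 2.
  move=> FG; rewrite /v (big_fset_split _ FG) (big_fset_split _ FG) /=.
  by rewrite addrAC subrr add0r addrAC subrr add0r sqnorm_combination.
have close (d : R) : 0 < d -> exists F : {fset J}, forall G, (F `<=` G)%fset ->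
    nrm (v G - v F) <= d.
  move=> d0; have d2 : 0 < d ^+ 2 / 2 by rewrite divr_gt0 // exprn_gt0.
  have [F _ hF] := hs _ d2; exists F => G FG.
  rewrite -(@ler_pXn2r _ 2) ?nnegrE ?ipnorm_ge0 ?(ltW d0) //.
  rewrite (ipnorm_sqr ipS) vFG //.
  have := hF G FG; have := hF F (fsubset_refl F); rewrite /= -!rmorphB !rnorm_real.
  by rewrite !ltr_norml; lra.
have [Fs hFs] := choice (fun k : nat => close k.+1%:R^-1 (ltac:(by rewrite invr_gt0))).
have small (d : R) : 0 < d -> exists N : nat, forall i, (N <= i)%N -> i.+1%:R^-1 <= d.
  move=> d0; exists (Num.truncn d^-1) => i Ni.
  rewrite -[leRHS]invrK lef_pV2 ?posrE ?invr_gt0 //.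
  by apply: le_trans (ltW (truncnS_gt _)) _; rewrite ler_nat.
have d2P (d : R) : 0 < d -> 0 < d / 2 by move=> d0; rewrite divr_gt0.
have both (d : R) k (a : V) : nrm (v (Fs k) - a) <= d / 2 -> k.+1%:R^-1 <= d / 2 ->
    forall G, (Fs k `<=` G)%fset -> nrm (v G - a) <= d.
  move=> h1 h2 G FG; rewrite (_ : v G - a = (v G - v (Fs k)) + (v (Fs k) - a)).
    by apply: le_trans (ipnormD ipS _ _) _; have := le_trans (hFs k G FG) h2; lra.
  by rewrite addrA subrK.
have [d d0|x hx] := Vc (fun k => v (Fs k)).
  have [N hN] := small _ (d2P d d0); exists N => i j Ni Nj.
  (* The sets [Fs k] need not increase; they are compared through their union. *)
  rewrite (_ : v (Fs i) - v (Fs j) =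
    (v (Fs i `|` Fs j)%fset - v (Fs j)) - (v (Fs i `|` Fs j)%fset - v (Fs i))); last first.
    by rewrite opprB [RHS]addrC addrA subrK.
  apply: le_trans (ipnormB ipS _ _) _.
  have := le_trans (hFs i _ (fsubsetUl (Fs i) (Fs j))) (hN i Ni).
  by have := le_trans (hFs j _ (fsubsetUr (Fs i) (Fs j))) (hN j Nj); lra.
exists x => d d0; have [N hN] := small _ (d2P d d0); have [M hM] := hx _ (d2P d d0).
exists (Fs (maxn N M)); apply: both; first by apply: hM; rewrite leq_maxr.
by apply: hN; rewrite leq_maxl.
Qed.

Lemma nrm_basis j : nrm (e j) = 1.
Proof. by rewrite /ipnorm /sqnorm eo eqxx sqrtr1. Qed.

Lemma riesz_fischer_coef (y : l2J) x : (forall d : R, 0 < d ->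
  exists F : {fset J}, forall G, (F `<=` G)%fset ->
    nrm (\sum_(i <- G) l2_val y i *: e i - x) <= d) ->
  forall j, S x (e j) = l2_val y j.
Proof.
move=> hx j; apply: rnorm_eq => d d0; have d2 : 0 < d / 2 by rewrite divr_gt0.
have [F hF] := hx _ d2; have := hF _ (fsubsetU1 j F).
set G := (j |` F)%fset => h.
rewrite -(@ip_combination (l2_val y) G j) ?fset1U1 // rnormB -(ipBl ipS).
apply: le_lt_trans (cauchy_schwarz ipS _ _) _.
by rewrite nrm_basis mulr1; apply: le_lt_trans h _; lra.
Qed.

Context (complete : ip_complete) (total : total_family).

Lemma coordinates_l2 x : exists y : l2J, l2_val y = fun j => S x (e j).
Proof. exact: l2_of_bounded (bessel x). Qed.

Definition coordinates x : l2J := projT1 (cid (coordinates_l2 x)).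

Lemma coordinatesE x j : l2_val (coordinates x) j = S x (e j).
Proof. by rewrite /coordinates; case: cid => y /= ->. Qed.

Lemma coordinates_linear : linear coordinates.
Proof.
move=> a x y; apply: l2_ext => j.
by rewrite l2_valD l2_valZ !coordinatesE (ipDl ipS) (ipZl ipS).
Qed.

Definition of_coordinates (y : l2J) : V := projT1 (cid (riesz_fischer y complete)).

Lemma of_coordinatesK : cancel of_coordinates coordinates.
Proof.
move=> y; apply: l2_ext => j; rewrite coordinatesE.
exact: (riesz_fischer_coef (projT2 (cid (riesz_fischer y complete)))).
Qed.

Lemma coordinates_inj : injective coordinates.
Proof.
move=> x y xy; apply/eqP; rewrite -subr_eq0; apply/eqP/total => j.
by rewrite (ipBl ipS) -!coordinatesE xy subrr.
Qed.

Lemma coordinatesK : cancel coordinates of_coordinates.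
Proof. by move=> x; apply: coordinates_inj; rewrite of_coordinatesK. Qed.

Lemma of_coordinates_linear : linear of_coordinates.
Proof.
move=> a x y; apply: coordinates_inj.
by rewrite coordinates_linear !of_coordinatesK.
Qed.

(** The partial sums defining [l2_ip] are inner products with [z] of the partial sums of the
    expansion of [x], which converge to [x]. *)
Lemma parseval x z : l2_ip (coordinates x) (coordinates z) = S x z.
Proof.
apply: l2_ipE => d d0.
have z1 : 0 < nrm z + 1 by rewrite ltr_wpDl ?ipnorm_ge0.
have dz : 0 < d / (nrm z + 1) by rewrite divr_gt0.
have := projT2 (cid (riesz_fischer (coordinates x) complete)).
rewrite -/(of_coordinates _) coordinatesK => /(_ _ dz)[F hF].
exists F => // G /= FG; have h := hF G FG.
have -> : \sum_(i <- G) l2_val (coordinates x) i * (l2_val (coordinates z) i)^* =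
    S (\sum_(i <- G) l2_val (coordinates x) i *: e i) z.
  rewrite (ip_suml ipS); apply: eq_bigr => i _.
  by rewrite (ipZl ipS) !coordinatesE -(ipC ipS).
rewrite -(ipBl ipS); apply: le_lt_trans (cauchy_schwarz ipS _ _) _.
apply: le_lt_trans (ler_wpM2r (ipnorm_ge0 _ _) h) _.
rewrite mulrAC ltr_pdivrMr // ltr_pM2l //; lra.
Qed.

End OrthonormalBases.

(** * From equivalent matrix norms to a complete isomorphism *)

Section Renorming.
Context {R : realType} (X : opspace R) (S : X -> X -> R[i]).
Context (ipS : inner_product S).
Context (c M : R) (c0 : 0 <= c) (M0 : 0 <= M).
Context (S_upper : forall k (x : 'M[X]_k), mxnorm x <= 1 -> ohle S x c).
Context (S_lower : forall k (x : 'M[X]_k), ohle S x 1 -> mxnorm x <= M).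
Local Notation C := R[i].
Local Notation toC := (real_complex R).
Local Notation "`[ a ]" := (mxnorm (const_mx a : 'M[X]_1)).

Lemma const_mxnormZ (l : C) a : `[l *: a] = rnorm l * `[a].
Proof. by rewrite -map_const_mx mxnormZ. Qed.

Lemma ohle_const_sqnorm a : ohle S (const_mx a : 'M_1) (sqnorm S a).
Proof.
move=> p q A B; rewrite /oform !big_ord1 !mxE (sqnormE ipS) -mulrA cReMr.
rewrite ler_wpM2l ?(sqnorm_ge0 ipS) //; apply: le_trans (Re_le_rnorm _) _.
rewrite rnormM rnorm_conj; apply: ler_pM; rewrite ?rnorm_ge0 //.
  by apply: le_trans (rnorm_le_hsnorm _ ord0 ord0); rewrite mxE.
by apply: le_trans (rnorm_le_hsnorm _ ord0 ord0); rewrite mxE.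
Qed.

(** The free [d > 0] replaces a division by [ipnorm S a], which may be zero as long as [S] is not
    known to be definite. *)
Lemma const_mxnorm_le a d : 0 < d -> ipnorm S a <= d -> `[a] <= M * d.
Proof.
move=> d0 ad; have dC : toC d * toC d^-1 = 1.
  by rewrite -rmorphM mulfV ?gt_eqF.
rewrite -[a]scale1r -dC -scalerA const_mxnormZ rnorm_real gtr0_norm // mulrC.
rewrite ler_wpM2r ?(ltW d0) //; apply: S_lower; apply: ohle_le (ohle_const_sqnorm _).
rewrite -(ipnorm_sqr ipS) (ipnormZ ipS) rnorm_real gtr0_norm ?invr_gt0 //.
by rewrite expr_le1 ?mulr_ge0 ?invr_ge0 ?ipnorm_ge0 ?(ltW d0) // mulrC ler_pdivrMr ?mul1r.
Qed.

Lemma ipnorm_le_const a d : 0 < d -> `[a] <= d -> ipnorm S a <= Num.sqrt c * d.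
Proof.
move=> d0 ad; have dC : toC d * toC d^-1 = 1.
  by rewrite -rmorphM mulfV ?gt_eqF.
rewrite -[a]scale1r -dC -scalerA (ipnormZ ipS) rnorm_real gtr0_norm // mulrC.
rewrite ler_wpM2r ?(ltW d0) // ler_wsqrtr //; apply: (ohle_const ipS).
apply: S_upper; rewrite const_mxnormZ rnorm_real gtr0_norm ?invr_gt0 //.
by rewrite mulrC ler_pdivrMr ?mul1r.
Qed.

(** A null vector satisfies [const_mxnorm_le] for every [d > 0], so its operator norm is arbitrarily
    small. Dividing by [M + 1] allows for [M = 0]. *)
Lemma S_definite a : sqnorm S a = 0 -> a = 0.
Proof.
move=> a0; have : `[a] = 0.
  apply/le_anti; rewrite mxnorm_ge0 andbT; apply/ler_addgt0Pl => e e0; rewrite addr0.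
  have M1 : 0 < M + 1 by rewrite ltr_wpDl.
  apply: (@le_trans _ _ (M * (e / (M + 1)))).
    apply: const_mxnorm_le; first by rewrite divr_gt0.
    by rewrite /ipnorm a0 sqrtr0 divr_ge0 ?ltW.
  by rewrite mulrCA ler_piMr ?(ltW e0) // ler_pdivrMr // mul1r lerDl.
by move=> /mxnorm_eq0 /matrixP /(_ ord0 ord0); rewrite !mxE.
Qed.

Lemma S_complete : ip_complete S.
Proof.
move=> u uc; have [|a ha] := @opspace_complete R X u.
  move=> e e0; have M1 : 0 < M + 1 by rewrite ltr_wpDl.
  have eM : 0 < e / (M + 1) by rewrite divr_gt0.
  have [N hN] := uc _ eM; exists N => i j Ni Nj.
  apply: le_trans (const_mxnorm_le eM (hN _ _ Ni Nj)) _.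
  by rewrite mulrCA ler_piMr ?(ltW e0) // ler_pdivrMr // mul1r lerDl.
exists a => d d0; have s1 : 0 < Num.sqrt c + 1 by rewrite ltr_wpDl ?sqrtr_ge0.
have dc : 0 < d / (Num.sqrt c + 1) by rewrite divr_gt0.
have [N hN] := ha _ dc; exists N => i Ni.
apply: le_trans (ipnorm_le_const dc (hN _ Ni)) _.
by rewrite mulrCA ler_piMr ?(ltW d0) // ler_pdivrMr // mul1r lerDl.
Qed.

Lemma cb_norm_lty (Y Z : mxnormed R) (u : Y -> Z) (K : R) :
  (forall n (x : 'M[Y]_n), mxnorm x <= 1 -> mxnorm (map_mx u x) <= K) ->
  (cb_norm u < +oo)%E.
Proof.
move=> h; apply: (@le_lt_trans _ _ K%:E); last exact: ltry.
apply: ge_ereal_sup => _ [n /= n0 <-]; apply: ge_ereal_sup => _ [x /= x1 <-].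
by rewrite lee_fin h.
Qed.

Lemma completely_isomorphic_OH : exists J : choiceType, completely_isomorphic X (OH R J).
Proof.
have [E [Eo Etot]] := maximal_orthonormal_set ipS.
pose J : choiceType := {x : X | x \in E}.
pose e (j : J) : X := val j.
have eE j : E (e j) by have := valP j; rewrite inE.
have eo (i j : J) : S (e i) (e j) = (i == j)%:R by rewrite Eo.
have tot : total_family S e.
  move=> x xe; apply: S_definite; apply: Etot => y Ey.
  have yE : y \in E by rewrite inE.
  exact: (xe (exist _ y yE)).
pose u : X -> OH R J := coordinates ipS eo.
pose v : OH R J -> X := of_coordinates ipS eo S_complete.
have uP : linear u by exact: coordinates_linear.
have vP : linear v by exact: of_coordinates_linear.
pose uL : {linear X -> OH R J} := HB.pack u (GRing.isLinear.Build _ _ _ _ u uP).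
pose vL : {linear OH R J -> X} := HB.pack v (GRing.isLinear.Build _ _ _ _ v vP).
(* By Parseval the coordinate map preserves Gram matrices, so the norm in OH(J) of an image is a
   function of [S], and the two bounds on [S] become the two cb-norm bounds. *)
have gramE n (x : 'M[X]_n) : gram (@l2_ip R J) (map_mx u x) = gram S x.
  by apply/matrixP => p q; rewrite !mxE; exact: parseval S_complete tot _ _.
exists J, uL, vL; split.
- exact: coordinatesK.
- exact: of_coordinatesK.
- apply: (@cb_norm_lty _ _ _ (Num.sqrt (16 * c))) => n x x1.
  rewrite /= oh_normE gramE ler_wsqrtr //.
  exact: (ohle_cmxnorm ipS c0 (S_upper x1)).
- apply: (@cb_norm_lty _ _ _ M) => n y y1.
  apply: S_lower; apply: ohle_le (cmxnorm_ohle _ _).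
  rewrite -gramE (_ : map_mx u (map_mx v y) = y).
    by rewrite -oh_norm_sqr expr_le1 ?oh_norm_ge0.
  by apply/matrixP => i j; rewrite !mxE; exact: of_coordinatesK.
Qed.

End Renorming.

Theorem theorem1p2 (R : realType) (I : choiceType) (X : opspace R) :
  almost_completely_coarsely_embeds X (OH R I) ->
  exists J : choiceType, completely_isomorphic X (OH R J).
Proof.
move=> /renorming_inner_product[S [ipS [c c0 upper] [M M0 lower]]].
exact: (completely_isomorphic_OH ipS c0 M0 upper lower).
Qed.
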